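(* Let $\mathcal{A}$ be a spectral algebra, $0<p_0\le1$, and $\omega$ an $(\mathcal{A},p_0)$-admissible weight. Let $T=(T_k)_{k\in X}$ be an intrinsically $\mathcal{A}$-localized g-frame for $\mathcal{H}$ and let $T^d=(T^d_k)_{k\in X}$ be an intrinsically $\mathcal{A}$-localized dual g-frame of $T$ such that $T^d\sim_{\mathcal{A}}T$. Then, for each $p\in(p_0,\infty]\cup\{0,1\}$, $$\mathcal{H}^p_\omega(T^d,T)=\mathcal{H}^p_\omega(T,T^d)$$ with equivalent (quasi-)norms, and $$f=\sum_{k\in X}T_k^*T^d_kf=\sum_{k\in X}(T^d_k)^*T_kf\qquad\text{for all } f\in\mathcal{H}^p_\omega(T^d,T),$$ with unconditional convergence in $\mathcal{H}^p_\omega(T^d,T)$ for $p<\infty$ (including $p=0$), and unconditional convergence in the $\sigma(\mathcal{H},\mathcal{H}^{00}(T^d))$-topology in the case $p=\infty$.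
   Context: $\mathcal{H}$ is a separable Hilbert space, $X\subset\mathbb{R}^d$ is countable; a weight is a continuous function $\omega:\mathbb{R}^d\to(0,\infty)$. g-frames. $T=(T_k)_{k\in X}\subset\mathcal{B}(\mathcal{H})$ is a g-frame if $A\|f\|^2\le\sum_k\|T_kf\|^2\le B\|f\|^2$ for all $f\in\mathcal H$ and some $0<A\le B<\infty$; it is g-Bessel if the upper bound holds. A dual g-frame of $T$ is a g-Bessel sequence $T^d=(T^d_k)_{k\in X}$ with $f=\sum_kT_k^*T^d_kf=\sum_k(T^d_k)^*T_kf$ for all $f\in\mathcal{H}$ (it is then itself a g-frame, and $T$ is a dual g-frame of it). For a g-frame $U$: $C_{U}f=(U_kf)_{k\in X}$, $D_U(f_k)_k=\sum_kU_k^*f_k$. Sequence spaces. For $0<p\le\infty$, $\ell^p_\omega(X;\mathcal{H})$ consists of $\mathcal{H}$-valued $(f_k)_{k\in X}$ with $\|(f_k)\|_{\ell^p_\omega(X;\mathcal H)}=\|(\|f_k\|\omega(k))_k\|_{\ell^p(X)}<\infty$. $\ell^{00}(X;\mathcal{H})$ is the space of finitely supported sequences and $\ell^0_\omega(X;\mathcal{H})$ its closure in $\ell^\infty_\omega(X;\mathcal{H})$, with the $\ell^\infty_\omega$-norm. Spectral algebra. A unital Banach *-algebra $\mathcal{A}$ of $\mathcal{B}(\mathcal{H})$-valued matrices $[A_{k,l}]_{k,l\in X}$ (matrix product, involution $[A_{k,l}]^*=[A_{l,k}^*]_{k,l}$, action $(Af)_k=\sum_lA_{k,l}f_l$) such that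 (1) $\mathcal{A}\subseteq\mathcal{B}(\ell^2(X;\mathcal{H}))$ via a unital *-monomorphism; (2) $A\in\mathcal{A}$ invertible in $\mathcal{B}(\ell^2(X;\mathcal{H}))$ implies $A^{-1}\in\mathcal{A}$; (3) $A\in\mathcal{A}$ and $\|B_{k,l}\|\le\|A_{k,l}\|$ for all $k,l$ imply $B\in\mathcal{A}$, $\|B\|_{\mathcal{A}}\le\|A\|_{\mathcal{A}}$. $U\sim_{\mathcal{A}}T$ means $G_{U,T}:=[U_kT_l^*]_{k,l\in X}\in\mathcal{A}$; $T$ is intrinsically $\mathcal{A}$-localized if $T\sim_{\mathcal{A}}T$. A weight $\omega$ is $(\mathcal{A},p_0)$-admissible if every $A\in\mathcal{A}$ defines a bounded operator on $\ell^p_\omega(X;\mathcal{H})$ for every $p\in(p_0,\infty]\cup\{1\}$. The spaces $\mathcal{H}^p_\omega(T^d,T)$ (for any g-frame $T$ and dual g-frame $T^d$ with $T^d\sim_{\mathcal A}T$; $\mathcal{H}^p_\omega(T,T^d)$ is obtained by exchanging roles). Let $\mathcal{H}^{00}(T)=D_T(\ell^{00}(X;\mathcal{H}))$. For $p\in(p_0,\infty)\cup\{0,1\}$, $\mathcal{H}^p_\omega(T^d,T)$ is the completion of $\mathcal{H}^{00}(T)$ with respect to the (quasi-)norm $\|f\|_{\mathcal{H}^p_\omega(T^d,T)}=\|C_{T^d}f\|_{\ell^p_\omega(X;\mathcal{H})}$; $C_{T^d}$ (hence each $T^d_k$) extends by density to an isometry into $\ell^p_\omega(X;\mathcal{H})$.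 Equivalently it is the completion, in the same (quasi-)norm, of $V^p_\omega(T^d,T)=\{f\in\mathcal{H}:C_{T^d}f\in\ell^p_\omega(X;\mathcal{H})\}\supseteq\mathcal{H}^{00}(T)$. For $p=\infty$: two sequences $\{f_n\},\{g_n\}$ in $\mathcal{H}$ are $(T^d,\omega)$-equivalent ($\sim_{T^d,\omega}$) if $\lim_n\|T^d_k(f_n-g_n)\|=0$ for all $k\in X$ and $\sup_n\|C_{T^d}(f_n-g_n)\|_{\ell^\infty_\omega(X;\mathcal{H})}<\infty$. $\mathcal{H}^\infty_\omega(T^d,T)$ is the space of classes $f=[\{f_n\}]_{\sim_{T^d,\omega}}$ such that $T^d_kf:=\lim_nT^d_kf_n$ exists in $\mathcal{H}$ for each $k$ and $\sup_n\|C_{T^d}f_n\|_{\ell^\infty_\omega(X;\mathcal{H})}<\infty$, with norm $\sup_k\|T^d_kf\|\omega(k)$. Equality of spaces. For $p<\infty$, $\mathcal{H}^p_\omega(T^d,T)=\mathcal{H}^p_\omega(T,T^d)$ with equivalent norms means that $V^p_\omega(T^d,T)=V^p_\omega(T,T^d)$ as subsets of $\mathcal{H}$ with equivalent (quasi-)norms, so that the completions are canonically identified. For $p=\infty$ it means that both spaces consist of the same equivalence classes of sequences in $\mathcal{H}$, with equivalent norms. Through this equality, both $T^d_kf$ and $T_kf$ are defined for $f\in\mathcal{H}^p_\omega(T^d,T)$. Convergence for $p=\infty$. $\sigma(\mathcal{H},\mathcal{H}^{00}(T^d))$ is the locally convex topology on $\mathcal{H}$ given by the seminorms $h\mapsto|\langle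 g,h\rangle|$, $g\in\mathcal{H}^{00}(T^d)=D_{T^d}(\ell^{00}(X;\mathcal{H}))$; elements of $\mathcal{H}^\infty_\omega(T^d,T)$ are viewed in its completion. A series $\sum_{l\in X}h_l$ with $h_l\in\mathcal{H}$ converges unconditionally to $f=[\{f_n\}]$ in this topology if for every nested sequence $F_1\subseteq F_2\subseteq\cdots$ of finite subsets with union $X$ and every $g\in\mathcal{H}^{00}(T^d)$, $\lim_n\langle\sum_{l\in F_n}h_l,g\rangle=\lim_n\langle f_n,g\rangle$. As elements of $\mathcal{H}^\infty_\omega(T^d,T)$, such series denote the classes of their partial sums over $F_n$. *)

(* Defs.v *)
From HB Require Import structures.
From mathcomp Require Import all_boot all_order all_algebra finmap complex.
From mathcomp Require Import all_classical all_reals all_analysis.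

Set Implicit Arguments.
Unset Strict Implicit.
Unset Printing Implicit Defensive.
Import Order.TTheory GRing.Theory Num.Theory numFieldNormedType.Exports.
Local Open Scope classical_set_scope.
Local Open Scope ring_scope.

(* A complex Hilbert space is a complete normed space over R[i] together with a
   positive definite hermitian form dot (linear on the left, conjugate-linear
   on the right) inducing its norm. *)
Definition is_hilbert (R : realType) (H : completeNormedModType R[i])
  (dot : {dot H for Num.conj}) : Prop :=
  forall f : H, `|f| ^+ 2 = dot f f.

Definition separable (T : topologicalType) : Prop :=
  exists2 S : set T, countable S & dense S.

(* In a normed space over R[i], `|v| is an element of R[i]; vnorm v is the same
   number, in R. *)
Definition vnorm (R : realType) (V : normedModType R[i]) (v : V) : R :=
  complex.Re `|v|.

Definition equiv_norms (R : realType) (E : Type) (S : set E)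
  (N1 N2 : E -> \bar R) : Prop :=
  exists c C : R, [/\ 0 < c, 0 < C &
    forall x, S x -> (c%:E * N1 x <= N2 x)%E /\ (N2 x <= C%:E * N1 x)%E].

Section UnconditionalSums.
Variables (R : realType) (I : choiceType).

Definition exhaustion (F : nat -> {fset I}) : Prop :=
  (forall n, F n `<=` F n.+1)%fset /\ (forall k, exists n, k \in F n).

(* The index set I is countable in every use, so that exhaustions exist. *)
Definition usum_to (V : normedModType R[i]) (h : I -> V) (s : V) : Prop :=
  forall F, exhaustion F -> (\sum_(k <- F n) h k) @[n --> \oo] --> s.

Definition usum (V : normedModType R[i]) (h : I -> V) : V := get (usum_to h).

End UnconditionalSums.

Section Operators.
Variables (R : realType) (H : completeNormedModType R[i]).
Variable dot : {dot H for Num.conj}.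

Definition bounded_op (T : H -> H) : Prop := linear T /\ continuous T.

Definition opnorm (T : H -> H) : R :=
  sup [set vnorm (T f) | f in [set f : H | vnorm f <= 1]].

Definition adj (T : H -> H) : H -> H :=
  get [set S : H -> H | forall f g, dot (T f) g = dot f (S g)].

End Operators.

Section SequenceSpaces.
Variables (R : realType) (H : completeNormedModType R[i]) (I : choiceType).

Definition ell00 : set (I -> H) := [set f | finite_set [set k | f k != 0]].

(* The (quasi-)norm of the weighted space l^p for p > 0; p = 0 stands for the
   space l^0, whose norm is the sup-norm. The element 0 is added to the set so
   that the supremum is 0, and not -oo, when I is empty. *)
Definition ell_norm (p : \bar R) (w : I -> R) (f : I -> H) : \bar R :=
  if (p == 0%E) || (p == +oo%E)
  then ereal_sup (0%E |` range (fun k => (vnorm (f k) * w k)%:E))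
  else ((\esum_(k in [set: I]) ((vnorm (f k) * w k) `^ fine p)%:E)
          `^ (fine p)^-1)%E.

Definition ell (p : \bar R) (w : I -> R) : set (I -> H) :=
  [set f | if p == 0%E
    then (ell_norm +oo w f < +oo)%E /\
         forall e : R, 0 < e ->
           exists2 g, ell00 g & (ell_norm +oo w (f - g)%R < e%:E)%E
    else (ell_norm p w f < +oo)%E].

Definition ell2 : set (I -> H) := ell 2%:E (fun=> 1).

Definition ell2_norm : (I -> H) -> \bar R := ell_norm 2%:E (fun=> 1).

End SequenceSpaces.

Section Matrices.
Variables (R : realType) (H : completeNormedModType R[i]) (I : choiceType).
Variable dot : {dot H for Num.conj}.

Definition mx := I -> I -> H -> H.

Definition mxid : mx := fun k l => if k == l then idfun else \0.

(* The series of operators is summed in the strong sense. *)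
Definition mxmul (M N : mx) : mx :=
  fun k l f => usum (fun m => M k m (N m l f)).

Definition mxstar (M : mx) : mx := fun k l => adj dot (M l k).

Definition act_cvg (M : mx) (f : I -> H) : Prop :=
  forall k, exists s, usum_to (fun l => M k l (f l)) s.

Definition act (M : mx) (f : I -> H) : I -> H :=
  fun k => usum (fun l => M k l (f l)).

Definition bounded_on (p : \bar R) (w : I -> R) (M : mx) : Prop :=
  exists C : R, forall f, ell p w f ->
    [/\ act_cvg M f, ell p w (act M f) &
        (ell_norm p w (act M f) <= C%:E * ell_norm p w f)%E].

Definition ell2_dot (f g : I -> H) : R[i] :=
  usum (fun k => dot (f k) (g k) : (R[i])^o).

(* Bounded operators of l^2(I; H), as total functions considered on ell2. *)
Definition ell2_bounded_op (S : (I -> H) -> (I -> H)) : Prop :=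
  [/\ forall f, @ell2 R H I f -> ell2 (S f),
      forall (a : R[i]) f g, ell2 f -> ell2 g ->
        S (a *: f + g) = a *: S f + S g &
      exists C : R, forall f, ell2 f ->
        (ell2_norm (S f) <= C%:E * ell2_norm f)%E].

(* M |-> act M is a unital *-monomorphism from A to the bounded operators of
   l^2(I; H). *)
Record ell2_representation (A : set mx) : Prop := Ell2Representation {
  rep_bounded : forall M, A M -> bounded_on 2%:E (fun=> 1) M ;
  rep_linear : forall (a : R[i]) M N f, A M -> A N -> ell2 f ->
    act (a *: M + N) f = a *: act M f + act N f ;
  rep_one : forall f, ell2 f -> act mxid f = f ;
  rep_mul : forall M N f, A M -> A N -> ell2 f ->
    act (mxmul M N) f = act M (act N f) ;
  rep_star : forall M f g, A M -> ell2 f -> ell2 g ->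
    ell2_dot (act M f) g = ell2_dot f (act (mxstar M) g) ;
  rep_inj : forall M N, A M -> A N ->
    (forall f, ell2 f -> act M f = act N f) -> M = N }.

(* The involution is not required to be isometric, nor the unit to have norm
   1. *)
Record spectral_algebra (A : set mx) (nA : mx -> R) : Prop := SpectralAlgebra {
  sa_entries : forall M, A M -> forall k l, bounded_op (M k l) ;
  sa_one : A mxid ;
  sa_add : forall M N, A M -> A N -> A (M + N) ;
  sa_scale : forall (a : R[i]) M, A M -> A (a *: M) ;
  sa_mul : forall M N, A M -> A N -> A (mxmul M N) ;
  sa_star : forall M, A M -> A (mxstar M) ;
  sa_norm_def : forall M, A M -> nA M = 0 -> M = 0 ;
  sa_norm_scale : forall (a : R[i]) M, A M ->
    nA (a *: M) = complex.Re `|a| * nA M ;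
  sa_norm_add : forall M N, A M -> A N -> nA (M + N) <= nA M + nA N ;
  sa_norm_mul : forall M N, A M -> A N -> nA (mxmul M N) <= nA M * nA N ;
  sa_complete : forall u : nat -> mx, (forall n, A (u n)) ->
    (forall e : R, 0 < e -> exists N, forall m n : nat,
       (N <= m)%N -> (N <= n)%N -> nA (u m - u n) < e) ->
    exists2 M, A M & nA (u n - M) @[n --> \oo] --> (0 : R) ;
  sa_rep : ell2_representation A ;
  sa_inverse_closed : forall M S, A M -> ell2_bounded_op S ->
    (forall f, ell2 f -> S (act M f) = f /\ act M (S f) = f) ->
    exists2 N, A N & forall f, ell2 f -> act N f = S f ;
  sa_solid : forall M N, A M -> (forall k l, bounded_op (N k l)) ->
    (forall k l, opnorm (N k l) <= opnorm (M k l)) ->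
    A N /\ nA N <= nA M }.

Definition admissible (A : set mx) (p0 : R) (w : I -> R) : Prop :=
  forall M, A M -> forall p : \bar R, (p0%:E < p)%E \/ p = 1%E ->
  bounded_on p w M.

End Matrices.

Section GFrames.
Variables (R : realType) (H : completeNormedModType R[i]) (I : choiceType).
Variable dot : {dot H for Num.conj}.
Implicit Types T U : I -> H -> H.

Definition gsum T (f : H) : \bar R :=
  (\esum_(k in [set: I]) (vnorm (T k f) ^+ 2)%:E)%E.

Definition g_bessel T : Prop :=
  (forall k, bounded_op (T k)) /\
  exists B : R, forall f, (gsum T f <= (B * vnorm f ^+ 2)%:E)%E.

Definition g_frame T : Prop :=
  (forall k, bounded_op (T k)) /\
  exists A B : R, [/\ 0 < A, A <= B &
    forall f, ((A * vnorm f ^+ 2)%:E <= gsum T f)%E /\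
              (gsum T f <= (B * vnorm f ^+ 2)%:E)%E].

Definition dual_g_frame T U : Prop :=
  g_bessel U /\
  forall f, usum_to (fun k => adj dot (T k) (U k f)) f /\
            usum_to (fun k => adj dot (U k) (T k f)) f.

Definition analysis U (f : H) : I -> H := fun k => U k f.

Definition synthesis U (f : I -> H) : H :=
  \sum_(k \in [set: I]) adj dot (U k) (f k).

Definition H00 U : set H := synthesis U @` @ell00 R H I.

Definition gram U T : mx H I := fun k l => U k \o adj dot (T l).

Definition localized (A : set (mx H I)) U T : Prop := A (gram U T).

End GFrames.

(* Co-orbit spaces H^p(U, T), in which (U, T) is (T^d, T) or (T, T^d); their
   elements are classes of sequences of vectors of H. *)
Section CoorbitSpaces.
Variables (R : realType) (H : completeNormedModType R[i]) (I : choiceType).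
Variables (dot : {dot H for Num.conj}) (w : I -> R).
Implicit Types (T U : I -> H -> H) (u v : nat -> H) (x y : set (nat -> H)).

Definition qnorm (p : \bar R) U (f : H) : \bar R :=
  ell_norm p w (analysis U f).

Definition Vspace (p : \bar R) U : set H := [set f | ell p w (analysis U f)].

Definition cauchy_in (p : \bar R) U u : Prop :=
  (forall n, Vspace p U (u n)) /\
  forall e : R, 0 < e -> exists N, forall m n : nat,
    (N <= m)%N -> (N <= n)%N -> (qnorm p U (u m - u n)%R < e%:E)%E.

Definition cauchy_class (p : \bar R) U u : set (nat -> H) :=
  [set v | cauchy_in p U v /\ qnorm p U (u n - v n) @[n --> \oo] --> 0%E].

(* The completion of H00 T for p < +oo, realized inside the completion of
   Vspace p U: its elements are the classes of those Cauchy sequences of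
   Vspace p U which are equivalent to a Cauchy sequence of H00 T. *)
Definition Hspace (p : \bar R) U T : set (set (nat -> H)) :=
  [set cauchy_class p U u | u in
    [set u | cauchy_in p U u /\ forall n, H00 dot T (u n)]].

Definition embed (p : \bar R) U (f : H) : set (nat -> H) :=
  cauchy_class p U (fun=> f).

Definition Hnorm (p : \bar R) U x : \bar R :=
  lim (qnorm p U (get x n) @[n --> \oo]).

Definition Hdist (p : \bar R) U x y : \bar R :=
  lim (qnorm p U (get x n - get y n) @[n --> \oo]).

Definition equivalent_oo U u v : Prop :=
  (forall k, U k (u n - v n) @[n --> \oo] --> (0 : H)) /\
  (ereal_sup (range (fun n => qnorm +oo U (u n - v n)%R)) < +oo)%E.

(* Both spaces H^oo(T^d, T) and H^oo(T, T^d) only depend on their first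
   argument. *)
Definition Hspace_oo U : set (set (nat -> H)) :=
  [set equivalent_oo U u | u in
    [set u | (forall k, cvg (U k (u n) @[n --> \oo])) /\
             (ereal_sup (range (fun n => qnorm +oo U (u n))) < +oo)%E]].

(* The extension of U_k to classes of sequences. *)
Definition ext U x : I -> H := fun k => lim (U k (get x n) @[n --> \oo]).

Definition ext_wd U x : Prop :=
  forall u, x u -> forall k, U k (u n) @[n --> \oo] --> ext U x k.

Definition Hnorm_oo U x : \bar R := ell_norm +oo w (ext U x).

Definition Hspace_sum_to (p : \bar R) U T (h : I -> H) x : Prop :=
  forall F, exhaustion F ->
    (forall n, Hspace p U T (embed p U (\sum_(k <- F n) h k))) /\
    Hdist p U (embed p U (\sum_(k <- F n) h k)) x @[n --> \oo] --> 0%E.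

(* Unconditional convergence of sum_k h_k to x in the topology
   sigma(H, H00 U): the limits of <., g> along the partial sums and along any
   representative of x exist and agree. *)
Definition sigma_sum_to U (h : I -> H) x : Prop :=
  forall F, exhaustion F -> forall g, H00 dot U g -> forall u, x u ->
  exists c : (R[i])^o,
    (dot (\sum_(k <- F n) h k) g : (R[i])^o) @[n --> \oo] --> c /\
    (dot (u n) g : (R[i])^o) @[n --> \oo] --> c.

(* The class of the partial sums of sum_k h_k is x. *)
Definition class_sum_to (h : I -> H) x : Prop :=
  forall F, exhaustion F -> x (fun n => \sum_(k <- F n) h k).

End CoorbitSpaces.

(* Main.v *)
(* From f = sum_l T_l^* Td_l f one gets C_T f = G_{T,T} C_Td f, and more
   generally C_T (f - sum_{l in F} T_l^* c_l) = G_{T,T} (C_Td f - 1_F c), so that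
   boundedness of the Gram matrices on l^p makes the norms of C_T and C_Td
   equivalent and reduces the convergence of the expansions to that of finite
   truncations in l^p.  For p = oo, truncations only converge coordinatewise;
   solidity of the algebra makes the rows of the Gram matrix absolutely summable
   against 1 / omega, and dominated convergence takes over. *)

Require Import Defs.
From HB Require Import structures.
From mathcomp Require Import all_boot all_order all_algebra finmap complex.
From mathcomp Require Import all_classical all_reals all_analysis.
From mathcomp Require Import ring lra.

Set Implicit Arguments.
Unset Strict Implicit.
Unset Printing Implicit Defensive.
Import Order.TTheory GRing.Theory Num.Theory numFieldNormedType.Exports.
Local Open Scope classical_set_scope.
Local Open Scope ring_scope.

(** The basic estimate has a direction: expanding [f] as the sum of the [adj dot (W k) (U k f)] and
    applying the operators [W k] bounds the [W]-norm by the [U]-norm, through the Gram matrix of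
    [W]. Hence the ordered notion [dual_pair U W], used for [Td, T] and for [T, Td]; partial sums
    synthesized with [W] are measured in the [W]-norm, and the reverse pair brings them back to the
    [U]-norm. Two obstacles shape the rest. For p < 1, a triangle inequality with a fixed constant
    would spoil both the Fatou lemma and the convergence of the quasi-norms along a Cauchy sequence;
    a factor [1 + e] with [e] arbitrary does not. For p = 0, admissibility is silent: boundedness on
    l^0 is pieced together from p = +oo, which gives the estimate, and p = 1, which makes images of
    finitely supported sequences approximable by truncations. Elements of the completions are sets
    of sequences in H, so equivalent norms give equal spaces, and not only isomorphic ones. *)

Section Vnorm.
Context {R : realType} {V : normedModType R[i]}.
Implicit Types (u v : V) (s : nat -> V).
Local Notation "x %:C" := (real_complex R x).

Lemma normE v : `|v| = (vnorm v)%:C.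
Proof. by rewrite /vnorm RRe_real // normr_real. Qed.

Lemma vnorm_ge0 v : 0 <= vnorm v.
Proof. by rewrite -ler0c -normE. Qed.

Lemma vnorm0 : vnorm (0 : V) = 0.
Proof. by rewrite /vnorm normr0. Qed.

Lemma vnorm0_eq0 v : vnorm v = 0 -> v = 0.
Proof. by move=> v0; apply/normr0_eq0; rewrite normE v0. Qed.

Lemma vnormN v : vnorm (- v) = vnorm v.
Proof. by rewrite /vnorm normrN. Qed.

Lemma vdistC u v : vnorm (u - v) = vnorm (v - u).
Proof. by rewrite -vnormN opprB. Qed.

Lemma vnormD u v : vnorm (u + v) <= vnorm u + vnorm v.
Proof. by rewrite -lecR rmorphD /= -!normE ler_normD. Qed.

Lemma vdist_trans w u v : vnorm (u - v) <= vnorm (u - w) + vnorm (w - v).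
Proof. by rewrite -[u - v](subrKA w); exact: vnormD. Qed.

Lemma vnormZ (a : R) v : 0 <= a -> vnorm (a%:C *: v) = a * vnorm v.
Proof.
move=> a0; apply: complexI.
by rewrite -normE normrZ normE rmorphM /= ger0_norm // ler0c.
Qed.

Lemma vnorm_sum (J : Type) (r : seq J) (f : J -> V) :
  vnorm (\sum_(i <- r) f i) <= \sum_(i <- r) vnorm (f i).
Proof.
elim/big_rec2: _ => [|i x y _ le]; first by rewrite vnorm0.
by rewrite (le_trans (vnormD _ _)) // lerD2l.
Qed.

(** A positive element of [R[i]] is real, so real epsilons suffice. *)
Lemma vcvgP s v : s n @[n --> \oo] --> v <->
  forall e : R, 0 < e -> exists N, forall n, (N <= n)%N -> vnorm (v - s n) < e.
Proof.
split=> [/cvgrPdist_lt sv e e0|sv].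
  have [|N _ h] := sv e%:C; first by rewrite ltcR.
  by exists N => n Nn; have := h n Nn; rewrite /= normE ltcR.
apply/cvgrPdist_lt => e e0.
have [k ek] : exists k : R, e = k%:C by apply/complex_realP/gtr0_real.
move: e0; rewrite ek ltcR => k0; have [N h] := sv _ k0.
by exists N => // n Nn; rewrite /= normE ltcR; exact: h.
Qed.

Lemma vcvg0P s : s n @[n --> \oo] --> (0 : V) <->
  forall e : R, 0 < e -> exists N, forall n, (N <= n)%N -> vnorm (s n) < e.
Proof.
split=> [/vcvgP h e /h|h]; last apply/vcvgP => e /h.
  by case=> N hN; exists N => n /hN; rewrite sub0r vnormN.
by case=> N hN; exists N => n /hN; rewrite sub0r vnormN.
Qed.

Lemma vcvg_dist s v :
  s n @[n --> \oo] --> v <-> (s n - v) @[n --> \oo] --> (0 : V).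
Proof.
split=> [/vcvgP h|/vcvg0P h]; [apply/vcvg0P|apply/vcvgP] => e /h [N hN];
by exists N => n /hN; rewrite vdistC.
Qed.

End Vnorm.

Lemma vcauchy_cvg (R : realType) (H : completeNormedModType R[i]) (s : nat -> H) :
  (forall e : R, 0 < e -> exists N, forall m n, (N <= m)%N -> (N <= n)%N ->
     vnorm (s m - s n) < e) ->
  cvg (s n @[n --> \oo]).
Proof.
move=> sC; apply: cauchy_cvg; apply: cauchy_exP => e e0.
have [k ek] : exists k : R, e = real_complex R k.
  by apply/complex_realP/gtr0_real.
move: e0; rewrite ek ltcR => k0; have [N h] := sC _ k0.
exists (s N), N => // n Nn; rewrite /= -ball_normE /= normE ltcR; exact: h.
Qed.

(** * Bounded operators and the operator norm *)

Section BoundedOperators.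
Context {R : realType} {H : completeNormedModType R[i]}.
Implicit Types (T : H -> H) (f g : H).
Local Notation "x %:C" := (real_complex R x).

Section Linearity.
Variable T : H -> H.
Hypothesis bT : bounded_op T.

Lemma bop0 : T 0 = 0.
Proof.
have := bT.1 (-1) 0 0; rewrite scaler0 addr0 scaleN1r addNr //.
Qed.

Lemma bopD f g : T (f + g) = T f + T g.
Proof. by have := bT.1 1 f g; rewrite !scale1r. Qed.

Lemma bopZ (a : R[i]) f : T (a *: f) = a *: T f.
Proof. by have := bT.1 a f 0; rewrite bop0 !addr0. Qed.

Lemma bopN f : T (- f) = - T f.
Proof. by rewrite -scaleN1r bopZ scaleN1r. Qed.

Lemma bopB f g : T (f - g) = T f - T g.
Proof. by rewrite bopD bopN. Qed.

Lemma bop_sum (J : Type) (r : seq J) (h : J -> H) :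
  T (\sum_(i <- r) h i) = \sum_(i <- r) T (h i).
Proof.
by elim: r => [|i r IH]; rewrite ?big_nil ?bop0 // !big_cons bopD IH.
Qed.

Lemma bop_bound : exists2 C : R, 0 < C & forall f, vnorm (T f) <= C * vnorm f.
Proof.
have /cvgrPdist_lt/(_ 1 ltr01) := bT.2 0.
rewrite bop0 => /nbhs_normP [e /= e0 he].
have [d ed] : exists d : R, e = d%:C by apply/complex_realP/gtr0_real.
move: e0; rewrite ed ltcR => d0.
have hd f : vnorm f < d -> vnorm (T f) < 1.
  move=> fd; have := he f; rewrite /= !sub0r !normrN !normE ed.
  by rewrite -[1]/(1%:C) !ltcR; apply.
exists (2 / d); first by rewrite divr_gt0.
move=> f; have [/vnorm0_eq0 ->|nf0] := eqVneq (vnorm f) 0.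
  by rewrite bop0 vnorm0 mulr0.
have nf : 0 < vnorm f by rewrite lt_neqAle eq_sym nf0 vnorm_ge0.
(* Rescaling [f] to norm [d / 2] puts it strictly inside the ball where [vnorm (T f) < 1]; this is
   the origin of [2 / d]. *)
set a := d / 2 / vnorm f.
have a0 : 0 < a by rewrite !divr_gt0.
have := hd (a%:C *: f); rewrite bopZ !vnormZ ?(ltW a0) //.
have -> : a * vnorm f = d / 2 by rewrite /a; field.
have d2 : d / 2 < d by lra.
move=> /(_ d2) h; rewrite -(ler_pM2l a0).
have -> : a * (2 / d * vnorm f) = 1 by rewrite /a; field; rewrite nf0 gt_eqF.
exact: ltW.
Qed.

(** Nonemptiness and boundedness make the [sup] in [opnorm] a true least upper bound rather than a
    default value. *)
Lemma opnorm_has_sup :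
  has_sup [set vnorm (T f) | f in [set f : H | vnorm f <= 1]].
Proof.
split; first by exists (vnorm (T 0)), 0 => //=; rewrite vnorm0.
have [C C0 hC] := bop_bound; exists C => _ [f /= f1 <-].
by apply: le_trans (hC f) _; rewrite ler_piMr // ltW.
Qed.

Lemma opnorm_ge0 : 0 <= opnorm T.
Proof.
rewrite -(vnorm0 (V := H)) -bop0; apply: ub_le_sup; first exact: opnorm_has_sup.2.
by exists 0 => //=; rewrite vnorm0.
Qed.

Lemma le_opnorm f : vnorm (T f) <= opnorm T * vnorm f.
Proof.
have [/vnorm0_eq0 ->|nf0] := eqVneq (vnorm f) 0.
  by rewrite bop0 vnorm0 mulr0.
have nf : 0 < vnorm f by rewrite lt_neqAle eq_sym nf0 vnorm_ge0.
rewrite -ler_pdivrMr // mulrC -vnormZ ?invr_ge0 ?(ltW nf) // -bopZ.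
apply: ub_le_sup; first exact: opnorm_has_sup.2.
by exists ((vnorm f)^-1%:C *: f) => //=; rewrite vnormZ ?invr_ge0 ?(ltW nf) // mulVf.
Qed.

End Linearity.

Lemma bounded_op_of_bound T (C : R) :
  linear T -> (forall f, vnorm (T f) <= C * vnorm f) -> bounded_op T.
Proof.
move=> lT hC; split => // f; apply/cvgrPdist_lt => e e0.
have [k ek] : exists k : R, e = k%:C by apply/complex_realP/gtr0_real.
move: e0; rewrite ek ltcR => k0.
have TB g h : T (g - h) = T g - T h.
  by have := lT (-1) h g; rewrite !scaleN1r ![- _ + _]addrC.
(* The sign of [C] is unknown and [C] may vanish, so [|C| + 1] serves as divisor. *)
have C1 : 0 < `|C| + 1 by rewrite ltr_wpDl.
apply/nbhs_normP; exists (k / (`|C| + 1))%:C; first by rewrite /= ltcR divr_gt0.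
move=> g; rewrite /= !normE !ltcR ltr_pdivlMr // => hg.
rewrite -TB; apply: le_lt_trans (hC _) _; apply: le_lt_trans hg.
rewrite mulrC ler_wpM2l ?vnorm_ge0 //.
by rewrite (le_trans (ler_norm _)) // lerDl.
Qed.

Lemma opnorm_le T (C : R) :
  0 <= C -> (forall f, vnorm (T f) <= C * vnorm f) -> opnorm T <= C.
Proof.
move=> C0 hC; apply: ge_sup; first by exists (vnorm (T 0)), 0 => //=; rewrite vnorm0.
by move=> _ [f /= f1 <-]; apply: le_trans (hC f) _; rewrite ler_piMr.
Qed.

Lemma bounded_op_scale (a : R) : 0 <= a -> bounded_op (fun f : H => a%:C *: f).
Proof.
move=> a0; apply: (@bounded_op_of_bound _ a) => [b f g|f].
  by rewrite scalerDr !scalerA mulrC.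
by rewrite vnormZ.
Qed.

Lemma bounded_op0 : bounded_op (\0 : H -> H).
Proof.
apply: (@bounded_op_of_bound _ 0) => [b f g|f] /=.
  by rewrite scaler0 addr0.
by rewrite vnorm0 mul0r.
Qed.

Lemma opnorm0 : opnorm (\0 : H -> H) = 0.
Proof.
apply/eqP; rewrite eq_le (opnorm_ge0 bounded_op0) andbT.
by apply: opnorm_le => // f; rewrite vnorm0 mul0r.
Qed.

Lemma le_opnorm2 T T' : bounded_op T' ->
  (forall f, vnorm (T f) <= vnorm (T' f)) -> opnorm T <= opnorm T'.
Proof.
move=> bT' h; apply: ge_sup; first by exists (vnorm (T 0)), 0 => //=; rewrite vnorm0.
move=> _ [f /= f1 <-]; apply: le_trans (h f) _.
by apply: ub_le_sup; [exact: (opnorm_has_sup bT').2|exists f].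
Qed.

End BoundedOperators.

(** * Finite sums, exhaustions and unconditional sums *)

Lemma ler_sum_fsubset (R : realType) (I : choiceType) (a : I -> R)
    (G G' : {fset I}) : (forall k, 0 <= a k) -> (G `<=` G')%fset ->
  \sum_(k <- G) a k <= \sum_(k <- G') a k.
Proof.
move=> a0 GG; rewrite [leRHS](big_fsetID _ (mem G)) /=.
have -> : [fset x in G' | x \in G]%fset = G.
  apply/fsetP => k; rewrite !inE andbC; case: (boolP (k \in G)) => //=.
  exact: (fsubsetP GG).
by rewrite lerDl sumr_ge0.
Qed.

Lemma sum_fsetU_disjoint (R : realType) (I : choiceType) (a : I -> R)
    (G G' : {fset I}) : [disjoint G & G']%fset ->
  \sum_(k <- (G `|` G')%fset) a k = \sum_(k <- G) a k + \sum_(k <- G') a k.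
Proof.
move=> dG; rewrite -big_cat; apply: perm_big.
apply: uniq_perm => [||k]; rewrite ?mem_cat ?inE //.
rewrite cat_uniq !fset_uniq andbT /=; apply/hasPn => k kG'.
by apply: contraL kG' => /(fdisjointP dG).
Qed.

Section Usum.
Context {R : realType} {I : choiceType}.
Hypothesis exh : exists F : nat -> {fset I}, exhaustion F.

Lemma exhaustion_mono (F : nat -> {fset I}) : exhaustion F ->
  forall m n, (m <= n)%N -> (F m `<=` F n)%fset.
Proof.
move=> [Fs _] m n /subnK <-; elim: (n - m)%N => [|k IH] //.
by rewrite addSn (fsubset_trans IH).
Qed.

(** Each point of [G] enters at some stage; the largest of these finitely many stages works by
    monotonicity. *)
Lemma exhaustion_sub (F : nat -> {fset I}) (G : {fset I}) : exhaustion F ->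
  exists N, forall n, (N <= n)%N -> (G `<=` F n)%fset.
Proof.
move=> eF; suff [N GN] : exists N, (G `<=` F N)%fset.
  by exists N => n Nn; rewrite (fsubset_trans GN) // exhaustion_mono.
have [g hg] := boolp.choice eF.2.
exists (\max_(k <- G) g k)%N; apply/fsubsetP => k kG.
have /fsubsetP : (F (g k) `<=` F (\max_(k <- G) g k)%N)%fset.
  by apply: exhaustion_mono => //; apply: leq_bigmax_seq.
exact.
Qed.

Section Basic.
Variable V : normedModType R[i].
Implicit Types (h : I -> V) (s : V).

(** This is where [exh] matters: with no exhaustion at all, [usum_to h] would hold vacuously of
    every value. *)
Lemma usum_to_uniq h s s' : usum_to h s -> usum_to h s' -> s = s'.
Proof.
have [F eF] := exh => /(_ F eF) hs /(_ F eF) hs'.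
by apply: (cvg_unique (@norm_hausdorff _ _)) hs hs'.
Qed.

Lemma usumE h s : usum_to h s -> usum h = s.
Proof.
by move=> hs; apply: (@usum_to_uniq h) => //; apply: (getI hs).
Qed.

Lemma usum_toD h h' s s' :
  usum_to h s -> usum_to h' s' -> usum_to (fun k => h k + h' k) (s + s').
Proof.
move=> hs hs' F eF; under eq_fun do rewrite big_split /=.
by apply: cvgD; [exact: hs|exact: hs'].
Qed.

Lemma usum_toN h s : usum_to h s -> usum_to (fun k => - h k) (- s).
Proof.
by move=> hs F eF; under eq_fun do rewrite sumrN; apply: cvgN; exact: hs.
Qed.

Lemma usum_toB h h' s s' :
  usum_to h s -> usum_to h' s' -> usum_to (fun k => h k - h' k) (s - s').
Proof. by move=> hs hs'; apply: usum_toD => //; exact: usum_toN. Qed.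

Lemma usum_to_fset (G : {fset I}) h :
  (forall k, k \notin G -> h k = 0) -> usum_to h (\sum_(k <- G) h k).
Proof.
move=> h0 F eF; have [N GN] := exhaustion_sub G eF.
apply/vcvgP => e e0; exists N => n /GN GF.
by rewrite (big_fset_incl _ GF) ?subrr ?vnorm0 // => k _ /h0.
Qed.

Lemma usum_to_le h s (a : I -> R) (B : R) :
  usum_to h s -> (forall k, vnorm (h k) <= a k) ->
  (forall G : {fset I}, \sum_(k <- G) a k <= B) -> vnorm s <= B.
Proof.
move=> hs ha hB; have [F eF] := exh.
apply/ler_addgt0Pr => e e0; have /vcvgP/(_ e e0) [N hN] := hs F eF.
have -> : s = (s - \sum_(k <- F N) h k) + \sum_(k <- F N) h k by rewrite subrK.
rewrite (le_trans (vnormD _ _)) // addrC lerD // ?(ltW (hN _ _)) //.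
rewrite (le_trans (vnorm_sum _ _)) // (le_trans _ (hB (F N))) //.
exact: ler_sum.
Qed.

End Basic.

Lemma usum_to_bop (H : completeNormedModType R[i]) (T : H -> H) (h : I -> H) s :
  bounded_op T -> usum_to h s -> usum_to (fun k => T (h k)) (T s).
Proof.
move=> bT hs F eF; under eq_fun do rewrite -(bop_sum bT).
by apply: continuous_cvg; [exact: bT.2|exact: hs].
Qed.

(** Dominated convergence for series: a finite set [G], chosen independently of [n], carries all but
    [e / 2] of the mass of [a], and on [G] only finitely many terms have to tend to 0. *)
Lemma usum_to_dominated (V : normedModType R[i]) (h : nat -> I -> V)
    (s : nat -> V) (a : I -> R) (B : R) :
  (forall G : {fset I}, \sum_(k <- G) a k <= B) ->
  (forall n k, vnorm (h n k) <= a k) ->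
  (forall k, h n k @[n --> \oo] --> (0 : V)) ->
  (forall n, usum_to (h n) (s n)) ->
  s n @[n --> \oo] --> (0 : V).
Proof.
move=> hB ha h0 hs; apply/vcvg0P => e e0.
have a0 k : 0 <= a k := le_trans (vnorm_ge0 _) (ha 0%N k).
pose S := [set \sum_(k <- G) a k | G in [set: {fset I}]].
have supS : has_sup S.
  by split; [exists (\sum_(k <- fset0%fset) a k), fset0%fset|exists B => _ [G _ <-]].
have e2 : 0 < e / 2 by rewrite divr_gt0.
have [_ [G _ <-] hG] := sup_adherent e2 supS.
have tail (G' : {fset I}) : [disjoint G & G']%fset -> \sum_(k <- G') a k <= e / 2.
  move=> dG; have : \sum_(k <- (G `|` G')%fset) a k <= sup S.
    by apply: ub_le_sup; [exact: supS.2|exists (G `|` G')%fset].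
  by rewrite sum_fsetU_disjoint //; lra.
have fin (r : seq I) : forall d : R, 0 < d -> exists N, forall n, (N <= n)%N ->
    \sum_(k <- r) vnorm (h n k) < d.
  elim: r => [|k r IH] d d0; first by exists 0%N => n _; rewrite big_nil.
  have d2 : 0 < d / 2 by rewrite divr_gt0.
  have [N1 h1] := IH _ d2; have /vcvg0P/(_ _ d2) [N2 h2] := h0 k.
  exists (maxn N1 N2) => n; rewrite geq_max => /andP[/h1 n1 /h2 n2].
  by rewrite big_cons (splitr d) ltrD.
have [N hN] := fin G _ e2; exists N => n /hN hn.
pose h1 k := if k \in G then h n k else 0.
have u1 : usum_to h1 (\sum_(k <- G) h1 k).
  by apply: usum_to_fset => k; rewrite /h1 => /negbTE ->.
have -> : s n = (s n - \sum_(k <- G) h1 k) + \sum_(k <- G) h1 k by rewrite subrK.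
rewrite (le_lt_trans (vnormD _ _)) // (splitr e) addrC ltr_leD //.
  rewrite (le_lt_trans (vnorm_sum _ _)) // (le_lt_trans _ hn) //.
  by rewrite big_seq [leRHS]big_seq ler_sum // => k kG; rewrite /h1 kG.
(* [a1] dominates the remainder [h n - h1], which vanishes on [G]; its finite sums are those of [a]
   over sets disjoint from [G]. *)
pose a1 k := if k \in G then 0 else a k.
apply: (usum_to_le (usum_toB (hs n) u1) (a := a1)) => [k|G'].
  by rewrite /h1 /a1; case: ifP; rewrite ?subrr ?vnorm0 ?subr0.
have sG : (G' `\` G `<=` G')%fset by exact: fsubsetDl.
rewrite -(big_fset_incl _ sG) => [|k kG']; last first.
  by rewrite inE kG' andbT negbK /a1 => ->.
rewrite (eq_big_seq a) ?tail // => [|k].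
  by apply/fdisjointP => x xG; rewrite inE xG.
by rewrite inE /a1 => /andP[/negbTE ->].
Qed.

End Usum.

(** * An almost additive inequality for real powers *)

Section PowerInequality.
Context {R : realType}.
Implicit Types a b r e : R.

Lemma powRVK r a : 0 < r -> 0 <= a -> (a `^ r) `^ r^-1 = a.
Proof. by move=> r0 a0; rewrite -powRrM divff ?gt_eqF // powRr1. Qed.

Lemma powRKV r a : 0 < r -> 0 <= a -> (a `^ r^-1) `^ r = a.
Proof. by move=> r0 a0; rewrite -powRrM mulVf ?gt_eqF // powRr1. Qed.

Lemma powR_gt1 r a : 0 < r -> 1 < a -> 1 < a `^ r.
Proof.
move=> r0 a1; have -> : 1 = 1 `^ r :> R by rewrite powR1.
by rewrite gt0_ltr_powR // nnegrE ltW // (lt_trans _ a1).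
Qed.

(** One argument for all [r > 0], concave or convex: with [(1 + d) ^ r = 1 + e], either [b <= d * a]
    and [a + b <= (1 + d) * a], or [a < b / d] and [b] absorbs [a] at the cost of a large
    constant. *)
Lemma powR_add_le r e : 0 < r -> 0 < e -> exists2 C, 0 < C &
  forall a b, 0 <= a -> 0 <= b -> (a + b) `^ r <= (1 + e) * a `^ r + C * b `^ r.
Proof.
move=> r0 e0; pose t := (1 + e) `^ r^-1.
have t1 : 1 < t by rewrite powR_gt1 ?invr_gt0 // ltrDl.
have tr : t `^ r = 1 + e by rewrite powRKV // addr_ge0 // ltW.
pose d := t - 1; have d0 : 0 < d by rewrite subr_gt0.
have c0 : 0 < 1 + d^-1 by rewrite addr_gt0 // invr_gt0.
exists ((1 + d^-1) `^ r) => [|a b a0 b0]; first exact: powR_gt0.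
have ab0 : 0 <= a + b by rewrite addr_ge0.
have [bd|bd] := leP b (d * a).
  rewrite -tr -powRM //; last by rewrite ltW // (lt_trans _ t1).
  rewrite (@le_trans _ _ ((t * a) `^ r)) //.
    rewrite ge0_ler_powR ?nnegrE ?(ltW r0) ?mulr_ge0 //.
      by rewrite ltW // (lt_trans _ t1).
    by move: bd; rewrite /d mulrBl mul1r; lra.
  by rewrite lerDl mulr_ge0 // powR_ge0.
rewrite -powRM // ?(ltW c0) // (@le_trans _ _ (((1 + d^-1) * b) `^ r)) //.
  rewrite ge0_ler_powR ?nnegrE ?(ltW r0) ?mulr_ge0 ?(ltW c0) //.
  rewrite mulrDl mul1r addrC lerD2l mulrC ler_pdivlMr // mulrC; exact: ltW.
by rewrite lerDr mulr_ge0 ?powR_ge0 // addr_ge0 // ltW.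
Qed.

End PowerInequality.

(** * Weighted sequence spaces and their quasi-norms *)

Section EllNorm.
Context {R : realType} {H : completeNormedModType R[i]} {I : choiceType}.
Variable w : I -> R.
Hypothesis w_gt0 : forall k, 0 < w k.
Implicit Types (f g h : I -> H) (p : \bar R) (G : {fset I}).

Definition wgt f k : R := vnorm (f k) * w k.

(** The quasi-norm seen on a finite index set. Its values are real, so estimates are proved here and
    carried over to [ell_norm] by [ell_norm_leP]. *)
Definition fnorm p f G : R :=
  if (p == 0%E) || (p == +oo%E) then \big[Num.max/0]_(k <- G) wgt f k
  else (\sum_(k <- G) wgt f k `^ fine p) `^ (fine p)^-1.

Definition trunc G f : I -> H := fun k => if k \in G then f k else 0.

Lemma wgt_ge0 f k : 0 <= wgt f k.
Proof. by rewrite mulr_ge0 ?vnorm_ge0 ?(ltW (w_gt0 k)). Qed.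

Lemma le_wgt f g k : (wgt f k <= wgt g k) = (vnorm (f k) <= vnorm (g k)).
Proof. by rewrite ler_pM2r. Qed.

Lemma wgtD f g k : wgt (f + g) k <= wgt f k + wgt g k.
Proof. by rewrite -mulrDl ler_wpM2r ?vnormD // ltW. Qed.

Lemma fnorm_sup p f G : (p == 0%E) || (p == +oo%E) ->
  fnorm p f G = \big[Num.max/0]_(k <- G) wgt f k.
Proof. by rewrite /fnorm => ->. Qed.

Lemma fnorm_fin (r : R) f G : 0 < r ->
  fnorm r%:E f G = (\sum_(k <- G) wgt f k `^ r) `^ r^-1.
Proof. by move=> r0; rewrite /fnorm eqe gt_eqF //=. Qed.

Definition exponent p := p = 0%E \/ (0 < p)%E.

Lemma exponentP p : exponent p ->
  ((p == 0%E) || (p == +oo%E)) \/ exists2 r : R, 0 < r & p = r%:E.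
Proof.
case=> [->|]; first by left; rewrite eqxx.
case: p => [r| |] //; last by left; rewrite eqxx orbT.
by rewrite lte_fin => r0; right; exists r.
Qed.

Lemma sum_wgt_ge0 f G (r : R) : 0 <= \sum_(k <- G) wgt f k `^ r.
Proof. by apply: sumr_ge0 => k _; exact: powR_ge0. Qed.

Lemma fnorm_fin_le (r : R) f G c : 0 < r -> 0 <= c ->
  (fnorm r%:E f G <= c) = (\sum_(k <- G) wgt f k `^ r <= c `^ r).
Proof.
move=> r0 c0; rewrite fnorm_fin //; apply/idP/idP => h.
  rewrite -[leLHS](powRKV r0 (sum_wgt_ge0 f G r)).
  by rewrite ge0_ler_powR ?nnegrE ?powR_ge0 // ltW.
rewrite -[leRHS](powRVK r0 c0).
by rewrite ge0_ler_powR ?nnegrE ?powR_ge0 ?invr_ge0 ?sum_wgt_ge0 // ltW.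
Qed.

Lemma fnorm_sup_le p f G c : (p == 0%E) || (p == +oo%E) -> 0 <= c ->
  (forall k, k \in G -> wgt f k <= c) -> fnorm p f G <= c.
Proof.
by move=> pE c0 h; rewrite fnorm_sup // big_seq; apply: bigmax_le.
Qed.

Lemma wgt_le_fnorm_sup p f G k : (p == 0%E) || (p == +oo%E) ->
  k \in G -> wgt f k <= fnorm p f G.
Proof. by move=> pE kG; rewrite fnorm_sup //; apply: le_bigmax_seq. Qed.

Lemma fnorm_ge0 p f G : 0 <= fnorm p f G.
Proof.
rewrite /fnorm; case: ifP => _; last exact: powR_ge0.
by elim/big_ind: _ => [|x y x0 _|k _] //; rewrite ?le_max ?x0 ?wgt_ge0.
Qed.

(** For the sup-norm, singletons already test the bound; for finite exponents, [esum] is the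
    supremum of finite sums and the outer power is increasing. *)
Lemma ell_norm_leP p f c : exponent p -> 0 <= c ->
  ((ell_norm p w f <= c%:E)%E <-> forall G, fnorm p f G <= c).
Proof.
move=> /exponentP[pE|[r r0 ->]] c0.
  rewrite /ell_norm pE; split=> [h G|h].
    apply: fnorm_sup_le => // k _; rewrite -lee_fin; apply: le_trans h.
    by apply: ereal_sup_ubound; right; exists k.
  apply: ge_ereal_sup => _ [->|[k _ <-]]; rewrite lee_fin //.
  apply: le_trans (h [fset k]%fset); apply: wgt_le_fnorm_sup => //.
  by rewrite inE.
rewrite /ell_norm eqe gt_eqF //=; set S := (\esum_(k in _) _)%E.
have S0 : (0 <= S)%E by apply: esum_ge0 => k _; rewrite lee_fin powR_ge0.
have -> : (S `^ r^-1 <= c%:E)%E <-> (S <= (c `^ r)%:E)%E.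
  split=> h.
    have -> : S = ((S `^ r^-1) `^ r)%E by rewrite -poweRrM mulVf ?gt_eqF // poweRe1.
    rewrite -poweR_EFin gt0_ler_poweR ?(ltW r0) //;
      rewrite in_itv /= ?leey ?andbT ?poweR_ge0 //.
  have -> : c%:E = ((c `^ r)%:E `^ r^-1)%E.
    by rewrite poweR_EFin powRVK.
  rewrite gt0_ler_poweR ?invr_ge0 ?(ltW r0) //;
      rewrite in_itv /= ?leey ?andbT ?lee_fin ?powR_ge0 //.
split=> [h G|h].
  rewrite fnorm_fin_le // -lee_fin; apply: le_trans h.
  rewrite -sumEFin; apply: esum_ge; exists [set` G] => //.
  by rewrite fsbig_finite //= set_fsetK.
apply: ge_ereal_sup => _ [A [fA _] <-].
rewrite fsbig_finite //= sumEFin lee_fin.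
by have := h (fset_set A); rewrite fnorm_fin_le.
Qed.

Lemma ell_norm_ge0 p f : (0 <= ell_norm p w f)%E.
Proof.
rewrite /ell_norm; case: ifP => _; last exact: poweR_ge0.
by apply: ereal_sup_ubound; left.
Qed.

Lemma le_fnorm p f G : exponent p ->
  ((fnorm p f G)%:E <= ell_norm p w f)%E.
Proof.
move=> ep; have := ell_norm_ge0 p f.
case E : (ell_norm p w f) => [c| |] //; rewrite ?leey // lee_fin => c0.
by rewrite lee_fin; apply: (ell_norm_leP f ep c0).1; rewrite E.
Qed.

Lemma le_fnorm2 p f g G : exponent p ->
  (forall k, vnorm (f k) <= vnorm (g k)) -> fnorm p f G <= fnorm p g G.
Proof.
move=> /exponentP[pE|[r r0 ->]] fg.
  apply: fnorm_sup_le => //; first exact: fnorm_ge0.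
  move=> k kG; rewrite (@le_trans _ _ (wgt g k)) ?le_wgt //.
  exact: wgt_le_fnorm_sup.
rewrite fnorm_fin_le ?fnorm_ge0 // fnorm_fin // powRKV ?sum_wgt_ge0 //.
apply: ler_sum => k _; rewrite ge0_ler_powR ?nnegrE ?wgt_ge0 ?(ltW r0) //.
by rewrite le_wgt.
Qed.

(* The almost triangle inequality replaces both Minkowski's inequality and its
   counterpart for p < 1; unlike a quasi-triangle inequality, it makes the
   quasi-norm continuous. *)
Lemma fnorm_almost_triangle p (e : R) : exponent p -> 0 < e ->
  exists2 C, 0 < C & forall f g G,
    fnorm p (f + g) G <= (1 + e) * fnorm p f G + C * fnorm p g G.
Proof.
move=> /exponentP[pE|[r r0 ->]] e0.
  exists 1 => // f g G; apply: fnorm_sup_le => // [|k kG].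
    by rewrite addr_ge0 ?mulr_ge0 ?fnorm_ge0 ?addr_ge0 ?(ltW e0).
  have hf := wgt_le_fnorm_sup f pE kG; have hg := wgt_le_fnorm_sup g pE kG.
  apply: le_trans (wgtD f g k) _; apply: lerD; last by rewrite mul1r.
  apply: le_trans hf _; rewrite ler_peMl ?fnorm_ge0 // lerDl.
  exact: ltW.
have e1 : 0 <= 1 + e by rewrite addr_ge0 // ltW.
(* The power inequality is used twice: with exponent [r] on each term (factor [t ^ r], which becomes
   [t] after the outer root) and with exponent [r^-1] on the sum (factor [t]). Together they cost
   [t * t = 1 + e]. *)
pose t := Num.sqrt (1 + e).
have tt : t * t = 1 + e by rewrite -expr2 sqr_sqrtr.
have t1 : 1 < t by rewrite -sqrtr1 ltr_sqrt ?ltrDl // ltr_wpDr // ltW.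
have t0 : 0 <= t by rewrite sqrtr_ge0.
have tr1 : 0 < t `^ r - 1 by rewrite subr_gt0 powR_gt1.
have ri0 : 0 < r^-1 by rewrite invr_gt0.
have [C C0 hC] := powR_add_le r0 tr1.
have te0 : 0 < t - 1 by rewrite subr_gt0.
have [D D0 hD] := powR_add_le ri0 te0.
exists (D * C `^ r^-1) => [|f g G]; first by rewrite mulr_gt0 ?powR_gt0.
rewrite !fnorm_fin //; set A := \sum_(k <- G) wgt f k `^ r.
set B := \sum_(k <- G) wgt g k `^ r.
have A0 : 0 <= A by exact: sum_wgt_ge0.
have B0 : 0 <= B by exact: sum_wgt_ge0.
have trA : 0 <= t `^ r * A by rewrite mulr_ge0 ?powR_ge0.
have CB : 0 <= C * B by rewrite mulr_ge0 // ltW.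
apply: (@le_trans _ _ ((t `^ r * A + C * B) `^ r^-1)).
  rewrite ge0_ler_powR ?nnegrE ?sum_wgt_ge0 ?addr_ge0 ?(ltW ri0) //.
  rewrite !mulr_sumr -big_split /=; apply: ler_sum => k _.
  have := hC _ _ (wgt_ge0 f k) (wgt_ge0 g k); rewrite [1 + _]addrC subrK.
  apply: le_trans; rewrite ge0_ler_powR ?nnegrE ?addr_ge0 ?wgt_ge0 ?(ltW r0) //.
  exact: wgtD.
apply: le_trans (hD _ _ trA CB) _.
rewrite [1 + _]addrC subrK !powRM ?powR_ge0 ?(ltW C0) // powRVK // !mulrA tt.
by [].
Qed.

Lemma fnorm_small p G (e : R) : exponent p -> 0 < e ->
  exists2 d, 0 < d & forall f, (forall k, k \in G -> wgt f k <= d) ->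
    fnorm p f G <= e.
Proof.
move=> /exponentP[pE|[r r0 ->]] e0.
  by exists e => // f hf; apply: fnorm_sup_le => //; exact: ltW.
(* Each term gets the share [e ^ r / n]; the successor keeps [n] positive when [G] is empty. *)
pose n := (size G).+1%:R : R; have n0 : 0 < n by rewrite ltr0n.
have er0 : 0 < e `^ r / n by rewrite divr_gt0 ?powR_gt0.
exists ((e `^ r / n) `^ r^-1) => [|f hf]; first exact: powR_gt0.
rewrite fnorm_fin_le ?(ltW e0) // (@le_trans _ _ (\sum_(k <- G) (e `^ r / n))) //.
  rewrite big_seq [leRHS]big_seq; apply: ler_sum => k kG.
  rewrite -[leRHS](powRKV r0) ?(ltW er0) //.
  by rewrite ge0_ler_powR ?nnegrE ?powR_ge0 ?wgt_ge0 ?(ltW r0) // hf.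
rewrite big_const_seq count_predT iter_addr_0 -mulr_natl mulrCA.
rewrite -[leRHS]mulr1 ler_wpM2l ?powR_ge0 // ler_pdivrMr // mul1r ler_nat.
exact: leqnSn.
Qed.

Lemma fnorm_support p f G G' : exponent p ->
  (forall k, k \notin G -> f k = 0) -> fnorm p f G' <= fnorm p f G.
Proof.
move=> /exponentP[pE|[r r0 ->]] f0.
  apply: fnorm_sup_le => //; first exact: fnorm_ge0.
  move=> k _; have [kG|/f0 fk0] := boolP (k \in G); first exact: wgt_le_fnorm_sup.
  by rewrite /wgt fk0 vnorm0 mul0r fnorm_ge0.
rewrite fnorm_fin_le ?fnorm_ge0 // fnorm_fin // powRKV ?sum_wgt_ge0 //.
have s : (G `<=` G `|` G')%fset by exact: fsubsetUl.
rewrite (big_fset_incl _ s) => [|k _ /f0 fk]; last first.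
  by rewrite /wgt fk vnorm0 mul0r powR0 // gt_eqF.
apply: ler_sum_fsubset; last exact: fsubsetUr.
by move=> k; exact: powR_ge0.
Qed.

Lemma ell_almost_triangle p (e : R) : exponent p -> 0 < e ->
  exists2 C, 0 < C & forall f g,
    (ell_norm p w (f + g)%R <= (1 + e)%:E * ell_norm p w f + C%:E * ell_norm p w g)%E.
Proof.
move=> ep e0; have [C C0 hC] := fnorm_almost_triangle ep e0.
have e1 : 0 < 1 + e by rewrite addr_gt0.
exists C => // f g.
have := ell_norm_ge0 p f; have := le_fnorm f _ ep.
have := ell_norm_ge0 p g; have := le_fnorm g _ ep.
case: (ell_norm p w f) => [a| |] //; case: (ell_norm p w g) => [b| |] // hg b0 hf a0;
  rewrite ?(gt0_muley _) ?lte_fin // ?addye ?addey ?leey // -?EFinM //.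
rewrite -EFinD; rewrite !lee_fin in a0 b0.
apply/ell_norm_leP => // [|G]; first by rewrite addr_ge0 ?mulr_ge0 // ltW.
apply: le_trans (hC _ _ _) _; rewrite lerD // ler_wpM2l ?(ltW e1) ?(ltW C0) //.
  by have := hf G; rewrite lee_fin.
by have := hg G; rewrite lee_fin.
Qed.

Lemma le_ell_norm p f g : exponent p -> (forall k, vnorm (f k) <= vnorm (g k)) ->
  (ell_norm p w f <= ell_norm p w g)%E.
Proof.
move=> ep fg; have := ell_norm_ge0 p g; have := le_fnorm g _ ep.
case: (ell_norm p w g) => [b| |] // hg b0; rewrite ?leey //.
rewrite lee_fin in b0; apply/(ell_norm_leP _ ep b0) => G.
by apply: le_trans (le_fnorm2 G ep fg) _; have := hg G; rewrite lee_fin.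
Qed.

Lemma ell_normN p f : exponent p -> ell_norm p w (- f)%R = ell_norm p w f.
Proof.
by move=> ep; apply/eqP; rewrite eq_le !le_ell_norm // => k; rewrite /= vnormN.
Qed.

Lemma ell_norm0 p : exponent p -> ell_norm p w (0 : I -> H) = 0%E.
Proof.
move=> ep; apply/eqP; rewrite eq_le ell_norm_ge0 andbT.
apply/(ell_norm_leP _ ep (lexx 0)) => G.
apply/ler_addgt0Pr => e e0; rewrite add0r.
have [d d0 hd] := fnorm_small G ep e0; apply: hd => k _.
by rewrite /wgt vnorm0 mul0r ltW.
Qed.

Lemma wgt_le_ell_norm p f k : exponent p -> ((wgt f k)%:E <= ell_norm p w f)%E.
Proof.
move=> ep; apply: le_trans (le_fnorm f [fset k]%fset ep); rewrite lee_fin.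
case/exponentP: ep => [pE|[r r0 ->]].
  by apply: wgt_le_fnorm_sup => //; rewrite inE.
by rewrite fnorm_fin // big_seq_fset1 powRVK ?wgt_ge0.
Qed.

(** On a finite [G], [f - u n] is eventually small; since the factor in front of [u n] can be taken
    arbitrarily close to 1, the same constant [c] survives in the limit. *)
Lemma ell_norm_fatou p (u : nat -> I -> H) f (c : R) : exponent p -> 0 <= c ->
  (forall k, u n k @[n --> \oo] --> f k) ->
  (exists N, forall n, (N <= n)%N -> (ell_norm p w (u n) <= c%:E)%E) ->
  (ell_norm p w f <= c%:E)%E.
Proof.
move=> ep c0 uf [N hN]; apply/(ell_norm_leP _ ep c0) => G.
apply/ler_addgt0Pr => e e0.
(* Chosen so that the excess [e' * c] is at most [e / 2], also when [c = 0]. *)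
pose e' := e / 2 / (c + 1).
have c1 : 0 < c + 1 by rewrite ltr_wpDl.
have e'0 : 0 < e' by rewrite !divr_gt0.
have [C C0 hC] := fnorm_almost_triangle ep e'0.
have eC : 0 < e / 2 / C by rewrite !divr_gt0.
have [d d0 hd] := fnorm_small G ep eC.
have near (r : seq I) : exists M, forall n, (M <= n)%N ->
    forall k, k \in r -> wgt (f - u n) k <= d.
  elim: r => [|k r [M hM]]; first by exists 0%N.
  have /vcvgP/(_ (d / w k)) [|M' hM'] := uf k; first by rewrite divr_gt0.
  exists (maxn M M') => n; rewrite geq_max => /andP[/hM nM /hM' nM'] l.
  rewrite inE => /orP[/eqP->|/nM //].
  by rewrite /wgt -ler_pdivlMr // ltW.
have [M hM] := near G; pose n := maxn N M.
have -> : f = u n + (f - u n) by rewrite addrC subrK.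
apply: le_trans (hC _ _ _) _.
have h1 : fnorm p (u n) G <= c.
  by apply: (ell_norm_leP _ ep c0).1; apply: hN; exact: leq_maxl.
have h2 : fnorm p (f - u n) G <= e / 2 / C.
  by apply: hd => k kG; apply: hM => //; exact: leq_maxr.
have h3 : (1 + e') * fnorm p (u n) G <= c + e / 2.
  rewrite mulrDl mul1r lerD //.
  apply: (@le_trans _ _ (e' * (c + 1))); last by rewrite /e' divfK // gt_eqF.
  by rewrite ler_wpM2l ?(ltW e'0) // (le_trans h1) // lerDl.
have h4 : C * fnorm p (f - u n) G <= e / 2.
  by rewrite mulrC -ler_pdivlMr.
by rewrite (splitr e) addrA lerD.
Qed.

Lemma ell_norm_lty_fset p f G : exponent p ->
  (forall k, k \notin G -> f k = 0) -> (ell_norm p w f < +oo)%E.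
Proof.
move=> ep f0; apply: (@le_lt_trans _ _ (fnorm p f G)%:E); last exact: ltry.
by apply/(ell_norm_leP _ ep (fnorm_ge0 _ _ _)) => G'; exact: fnorm_support.
Qed.

Lemma ell00P f : @ell00 R H I f <-> exists G, forall k, k \notin G -> f k = 0.
Proof.
split=> [ff|[G hG]].
  exists (fset_set [set k | f k != 0]) => k.
  rewrite (in_fset_set ff) notin_setE /= => /negP.
  by rewrite negbK => /eqP.
apply: (sub_finite_set _ (finite_fset G)) => k /=.
by apply: contra_neqT => /hG.
Qed.

Lemma truncE G f k : k \notin G -> trunc G f k = 0.
Proof. by rewrite /trunc => /negbTE ->. Qed.

Lemma ell00_trunc G f : @ell00 R H I (trunc G f).
Proof. by apply/ell00P; exists G => k; exact: truncE. Qed.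

Lemma ell_norm_zero f : ell_norm 0%E w f = ell_norm +oo%E w f.
Proof. by rewrite /ell_norm !eqxx orbT. Qed.

Lemma ell_norm_lty p f : exponent p -> ell p w f -> (ell_norm p w f < +oo)%E.
Proof.
by rewrite /ell /= => _; case: eqP => [-> []|//]; rewrite ell_norm_zero.
Qed.

Lemma ell_norm_fin p f : exponent p -> ell p w f ->
  exists2 c, 0 <= c & ell_norm p w f = c%:E.
Proof.
move=> ep /(ell_norm_lty ep); have := ell_norm_ge0 p f.
by case: ell_norm => [c c0 _| |] //; exists c.
Qed.

Lemma ell_ell00 p f : exponent p -> @ell00 R H I f -> ell p w f.
Proof.
move=> ep f0; have /ell00P [G hG] := f0.
rewrite /ell /=; case: eqP => _; last exact: ell_norm_lty_fset hG.
split; first by apply: ell_norm_lty_fset hG; right.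
by move=> e e0; exists f => //; rewrite subrr ell_norm0 ?lte_fin //; right.
Qed.

Lemma ell_normD_lty p f g : exponent p ->
  (ell_norm p w f < +oo -> ell_norm p w g < +oo -> ell_norm p w (f + g)%R < +oo)%E.
Proof.
move=> ep; have [C C0 hC] := ell_almost_triangle ep ltr01.
move=> fo go; apply: le_lt_trans (hC f g) _.
have := ell_norm_ge0 p f; have := ell_norm_ge0 p g.
move: fo go; case: (ell_norm p w f) => [a| |] //; case: (ell_norm p w g) => [b| |] //.
by move=> *; rewrite -!EFinM -EFinD ltry.
Qed.

Lemma ell_norm_small p (e : R) : exponent p -> 0 < e ->
  exists2 d, 0 < d & forall f g, (ell_norm p w f <= d%:E -> ell_norm p w g <= d%:E ->
    ell_norm p w (f + g)%R < e%:E)%E.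
Proof.
move=> ep e0; have [C C0 hC] := ell_almost_triangle ep ltr01.
have C2 : 0 < C + 3 by rewrite addr_gt0.
exists (e / (C + 3)) => [|f g hf hg]; first by rewrite divr_gt0.
apply: le_lt_trans (hC f g) _.
apply: (@le_lt_trans _ _ ((1 + 1)%:E * (e / (C + 3))%:E + C%:E * (e / (C + 3))%:E)%E).
  by rewrite leeD // lee_pmul ?ell_norm_ge0 ?lee_fin // ltW.
rewrite -!EFinM -EFinD lte_fin -mulrDl mulrA ltr_pdivrMr // mulrC ltr_pM2l //.
by rewrite addrC ltrD2l; lra.
Qed.

Lemma ellN p f : exponent p -> ell p w f -> ell p w (- f).
Proof.
move=> ep; have eo : exponent +oo by right.
rewrite /ell /=; case: eqP => _; last by rewrite ell_normN.
case=> fo fa; split=> [|e /fa [g /ell00P[G hG] ge]]; first by rewrite ell_normN.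
exists (- g); last by rewrite -opprD ell_normN.
by apply/ell00P; exists G => k /hG /=; rewrite /GRing.opp /= => ->; rewrite oppr0.
Qed.

Lemma ellD p f g : exponent p -> ell p w f -> ell p w g -> ell p w (f + g).
Proof.
move=> ep; have eo : exponent +oo by right.
rewrite /ell /=; case: eqP => _; last exact: ell_normD_lty.
move=> [fo fa] [go ga]; split=> [|e e0]; first exact: ell_normD_lty.
have [d d0 hd] := ell_norm_small eo e0.
have [f' /ell00P[G hG] ff] := fa _ d0; have [g' /ell00P[G' hG'] gg] := ga _ d0.
exists (f' + g'); last by rewrite opprD addrACA hd ?ltW.
apply/ell00P; exists (G `|` G')%fset => k; rewrite inE negb_or => /andP[/hG f0 /hG' g0].
by rewrite /GRing.add /= f0 g0 addr0.
Qed.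

Lemma ellB p f g : exponent p -> ell p w f -> ell p w g -> ell p w (f - g).
Proof. by move=> ep fp gp; apply: (ellD ep fp); exact: (ellN ep gp). Qed.

(** The way to place limits in the space when p = 0, where a finite norm is not enough: an
    approximant of an approximant is again finitely supported. *)
Lemma ell_closed p f : exponent p ->
  (forall e : R, 0 < e -> exists2 g, ell p w g & (ell_norm p w (f - g)%R < e%:E)%E) ->
  ell p w f.
Proof.
move=> ep; have eo : exponent +oo by right.
rewrite /ell /=; case: eqP => p0 hf.
  split=> [|e e0].
    have [g [go _] fg] := hf _ ltr01; rewrite -[f](subrK g) ell_normD_lty //.
    by move: fg; rewrite p0 ell_norm_zero => /lt_trans; apply; exact: ltry.
  have [d d0 hd] := ell_norm_small eo e0.
  have [g [go ga] fg] := hf _ d0; have [g' g'0 gg] := ga _ d0.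
  exists g' => //; rewrite -(subrKA g) hd ?(ltW gg) //.
  by move: fg; rewrite p0 ell_norm_zero => /ltW.
have [g go fg] := hf _ ltr01; rewrite -[f](subrK g) ell_normD_lty //.
by apply: lt_trans fg _; exact: ltry.
Qed.

(** Uniformity over all [G'] containing [G] is what yields unconditional convergence. For p = 0, [G]
    supports an approximant [g], and off [G] the sequence [f] coincides with [f - g]; for finite p >
    0, [G] nearly attains the supremum of the finite sums. *)
Lemma ell_trunc p f (e : R) : exponent p -> (p < +oo)%E -> ell p w f -> 0 < e ->
  exists G, forall G', (G `<=` G')%fset -> (ell_norm p w (f - trunc G' f)%R <= e%:E)%E.
Proof.
move=> ep poo fp e0.
case/exponentP: (ep) => [/orP[/eqP p0|/eqP pE]|[r r0 pE]].
- move: fp; rewrite /ell /= p0 eqxx => -[_ /(_ _ e0) [g /ell00P[G hG] ge]].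
  exists G => G' /fsubsetP GG.
  have eo : exponent +oo by right.
  apply: le_trans (ltW ge); rewrite ell_norm_zero; apply: (le_ell_norm eo) => k.
  rewrite /trunc /GRing.add /GRing.opp /=; case: ifPn => kG.
    by rewrite subrr vnorm0 vnorm_ge0.
  by rewrite hG ?subr0 // (contra (GG k)).
- by rewrite pE in poo.
have [c c0 fc] := ell_norm_fin ep fp.
pose S := [set \sum_(k <- G) wgt f k `^ r | G in [set: {fset I}]].
have hS G : \sum_(k <- G) wgt f k `^ r <= c `^ r.
  rewrite -fnorm_fin_le // -lee_fin -pE -fc; exact: le_fnorm.
have supS : has_sup S.
  split; first by exists (\sum_(k <- fset0%fset) wgt f k `^ r), fset0%fset.
  by exists (c `^ r) => _ [G _ <-].
have er0 : 0 < e `^ r by exact: powR_gt0.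
have [_ [G _ <-] hG] := sup_adherent er0 supS.
exists G => G' GG; apply/(ell_norm_leP _ ep (ltW e0)) => F; rewrite pE.
rewrite fnorm_fin_le ?(ltW e0) //.
rewrite (@le_trans _ _ (\sum_(k <- (F `\` G')%fset) wgt f k `^ r)) //.
  have sF : (F `\` G' `<=` F)%fset by exact: fsubsetDl.
  rewrite -(big_fset_incl _ sF) => [|k kF]; last first.
    rewrite inE kF andbT negbK /wgt /trunc /GRing.add /GRing.opp /= => ->.
    by rewrite subrr vnorm0 mul0r powR0 // gt_eqF.
  rewrite big_seq [leRHS]big_seq; apply: ler_sum => k.
  rewrite inE /wgt /trunc /GRing.add /GRing.opp /= => /andP[/negbTE -> _].
  by rewrite subr0.
(* [G] alone already exceeds [sup S - e ^ r], which leaves less than [e ^ r] for the disjoint set of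
   indices of [F] outside [G']. *)
have : \sum_(k <- (G `|` (F `\` G'))%fset) wgt f k `^ r <= sup S.
  by apply: ub_le_sup; [exact: supS.2|exists (G `|` (F `\` G'))%fset].
rewrite sum_fsetU_disjoint; first lra.
by apply/fdisjointP => k /(fsubsetP GG) kG; rewrite inE kG.
Qed.

End EllNorm.

Lemma usum_to_single (R : realType) (I : choiceType) (V : normedModType R[i])
    (h : I -> V) k : (forall l, l != k -> h l = 0) -> usum_to h (h k).
Proof.
move=> h0; have -> : h k = \sum_(l <- [fset k]%fset) h l by rewrite big_seq_fset1.
by apply: usum_to_fset => l; rewrite inE; exact: h0.
Qed.

(** * Adjoints *)

Section Hilbert.
Context {R : realType} {H : completeNormedModType R[i]}.
Variable dot : {dot H for Num.conj}.
Hypothesis hilb : is_hilbert dot.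

Lemma dot_inj g : (forall f, dot f g = 0) -> g = 0.
Proof.
move=> g0; have := hilb g; rewrite g0 => /eqP.
by rewrite expf_eq0 /= normr_eq0 => /eqP.
Qed.

(** [adj] is a choice operator, so its defining identity is available only once some adjoint is
    known to exist. *)
Lemma adj_spec T : (exists S, forall f g, dot (T f) g = dot f (S g)) ->
  forall f g, dot (T f) g = dot f (adj dot T g).
Proof. exact: (@getPex _ [set S | forall f g, dot (T f) g = dot f (S g)]). Qed.

Lemma adj_zero : adj dot (\0 : H -> H) = \0.
Proof.
have hS : exists S : H -> H, forall f g, dot ((\0 : H -> H) f) g = dot f (S g).
  by exists \0 => f g; rewrite linear0l linear0r.
apply/funext => g; apply: dot_inj => f.
by rewrite -(adj_spec hS) linear0l.
Qed.

Lemma adj_at0 T : (forall f g, dot (T f) g = dot f (adj dot T g)) ->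
  adj dot T 0 = 0.
Proof. by move=> hT; apply: dot_inj => f; rewrite -hT linear0r. Qed.

End Hilbert.

(** * Consequences of the spectral algebra axioms and of admissibility *)

Section Algebra.
Context {R : realType} {H : completeNormedModType R[i]} {I : choiceType}.
Variables (dot : {dot H for Num.conj}) (A : set (mx H I)) (nA : mx H I -> R).
Variables (p0 : R) (w : I -> R).
Hypothesis exh : exists F : nat -> {fset I}, exhaustion F.
Hypothesis hilb : is_hilbert dot.
Hypothesis salg : spectral_algebra dot A nA.
Hypothesis p0_gt0 : 0 < p0.
Hypothesis w_gt0 : forall k, 0 < w k.
Hypothesis adm : admissible A p0 w.
Local Notation "x %:C" := (real_complex R x).

(* The adjoint of B is read off the adjoint of the matrix with the single entry
   B, which belongs to A by solidity. *)
Lemma adjP (B : H -> H) (k0 : I) : bounded_op B ->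
  forall f g, dot (B f) g = dot f (adj dot B g).
Proof.
move=> bB f g; have [C C0 hC] := bop_bound bB.
pose M : mx H I := fun k l => if (k == k0) && (l == k0) then B else \0.
have bM k l : bounded_op (M k l).
  by rewrite /M; case: ifP => // _; exact: bounded_op0.
(* [C] bounds [B], so this multiple of the unit dominates [M] entrywise, as solidity requires. *)
have AC : A (C%:C *: mxid (H:=H) (I:=I)).
  exact: (sa_scale salg _ (sa_one salg)).
have [AM _] : A M /\ nA M <= nA (C%:C *: mxid (H:=H) (I:=I)).
  apply: (sa_solid salg AC bM) => k l.
  have bC := sa_entries salg AC k l.
  rewrite /M; case: ifP => [/andP[/eqP-> /eqP->]|_].
    apply: le_opnorm2; first exact: (sa_entries salg AC).
    move=> h; have -> : (C%:C *: mxid (H:=H) (I:=I)) k0 k0 h = C%:C *: h.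
      have -> : (C%:C *: mxid (H:=H) (I:=I)) k0 k0 h = C%:C *: mxid k0 k0 h by [].
      by rewrite /mxid eqxx.
    by rewrite vnormZ // ltW.
  by rewrite opnorm0 opnorm_ge0.
pose single (h : H) : I -> H := fun k => if k == k0 then h else 0.
have s2 h : ell2 (single h).
  apply: ell_ell00 => [k||]; [exact: ltr01|by right; rewrite lte_fin|].
  apply/ell00P; exists [fset k0]%fset => k.
  by rewrite inE /single => /negbTE ->.
have sE h : single h k0 = h by rewrite /single eqxx.
have s0 h k : k != k0 -> single h k = 0 by rewrite /single => /negbTE ->.
(* Both inner products reduce to their [k0] term. As [mxstar] is built from [adj], the identity
   concerns the very operator chosen by [adj]. *)
have := rep_star (sa_rep salg) AM (s2 f) (s2 g).
rewrite /ell2_dot.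
have MB : M k0 k0 = B by rewrite /M eqxx.
have M0 k l : (k != k0) || (l != k0) -> M k l = \0.
  by rewrite -negb_and /M => /negbTE ->.
have actM : act M (single f) k0 = B f.
  have := @usum_to_single R I H (fun l => M k0 l (single f l)) k0.
  rewrite MB sE => h; apply: (usumE exh); apply: h => l lk.
  by rewrite M0 // lk orbT.
have actMs : act (mxstar dot M) (single g) k0 = adj dot B g.
  have := @usum_to_single R I H (fun l => adj dot (M l k0) (single g l)) k0.
  rewrite MB sE => h; apply: (usumE exh); apply: h => l lk.
  by rewrite s0 // M0 ?lk // adj_zero.
have -> : usum (fun k => dot (act M (single f) k) (single g k) : (R[i])^o) =
    dot (B f) g.
  have := @usum_to_single R I ((R[i])^o : normedModType R[i])
     (fun k => dot (act M (single f) k) (single g k) : (R[i])^o) k0.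
  rewrite actM sE => h; apply: (usumE exh); apply: h => l /s0 ->.
  by rewrite linear0r.
move=> ->.
have := @usum_to_single R I ((R[i])^o : normedModType R[i])
   (fun k => dot (single f k) (act (mxstar dot M) (single g) k) : (R[i])^o) k0.
rewrite actMs sE => h; apply: (usumE exh); apply: h => l /s0 ->.
by rewrite linear0l.
Qed.

(* By solidity, the matrix of the scalar operators |M_kl| is in A; applied to
   the bounded sequence h / w its rows give absolutely convergent series. *)
Lemma row_summable M k : A M -> exists S : R, forall G : {fset I},
  \sum_(l <- G) opnorm (M k l) / w l <= S.
Proof.
move=> AM; pose a l := opnorm (M k l) / w l.
have bM := sa_entries salg AM.
have a0 l : 0 <= a l by rewrite divr_ge0 ?(ltW (w_gt0 l)) ?opnorm_ge0.
(* If H is trivial there is no test vector, but all operator norms vanish. *)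
have [[h h0]|noh] := pselect (exists h : H, vnorm h != 0); last first.
  exists 0 => G; rewrite big1 // => l _.
  have : opnorm (M k l) <= 0.
    apply: opnorm_le => // f; rewrite mul0r; have [->//|f0] := eqVneq (vnorm (M k l f)) 0.
    by case: noh; exists (M k l f).
  move=> o0; have -> : opnorm (M k l) = 0.
    by apply/eqP; rewrite eq_le o0 opnorm_ge0.
  by rewrite mul0r.
have h_gt0 : 0 < vnorm h by rewrite lt_neqAle eq_sym h0 vnorm_ge0.
pose N : mx H I := fun i j f => (opnorm (M i j))%:C *: f.
have [AN _] : A N /\ nA N <= nA M.
  apply: (sa_solid salg AM) => i j.
    by apply: bounded_op_scale; exact: opnorm_ge0.
  apply: opnorm_le => [|f]; first exact: opnorm_ge0.
  by rewrite vnormZ // opnorm_ge0.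
have oo : (p0%:E < +oo)%E by exact: ltry.
have [C hC] := adm AN (or_introl oo).
pose g l := (w l)^-1%:C *: h.
have gl l : wgt w g l = vnorm h.
  by rewrite /wgt vnormZ ?invr_ge0 ?(ltW (w_gt0 l)) // mulrC mulVKf ?gt_eqF.
have ellg : ell +oo w g.
  have eo : exponent (+oo : \bar R) by right.
  rewrite /ell /=; apply: (@le_lt_trans _ _ (vnorm h)%:E); last exact: ltry.
  apply/(ell_norm_leP _ _ eo (vnorm_ge0 h)) => G.
  apply: fnorm_sup_le => //; first exact: vnorm_ge0.
  by move=> l _; rewrite gl.
have [cv _ _] := hC _ ellg; have [s hs] := cv k.
(* All terms of the series are nonnegative multiples of the same [h], so its partial sums do not
   cancel: a late one dominates the sum over [G] and has norm at most [vnorm s + 1]. *)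
have [F eF] := exh; have /vcvgP/(_ 1 ltr01) [n1 hn1] := hs F eF.
exists ((vnorm s + 1) / vnorm h) => G; rewrite ler_pdivlMr //.
have [n2 hn2] := exhaustion_sub G eF; pose n := maxn n1 n2.
have {hn1} h1 := hn1 n (leq_maxl _ _); have {hn2} h2 := hn2 n (leq_maxr _ _).
apply: (@le_trans _ _ ((\sum_(l <- F n) a l) * vnorm h)).
  by rewrite ler_pM2r //; exact: ler_sum_fsubset.
have E : \sum_(l <- F n) N k l (g l) = (\sum_(l <- F n) a l)%:C *: h.
  rewrite rmorph_sum scaler_suml; apply: eq_bigr => l _.
  by rewrite /N /g scalerA -rmorphM.
rewrite -vnormZ ?sumr_ge0 // -E -[X in vnorm X](subrK s).
rewrite (le_trans (vnormD _ _)) // addrC lerD2l vdistC; exact: ltW.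
Qed.

Lemma bounded_on_pos (p : \bar R) (M : mx H I) : exponent p -> bounded_on p w M ->
  exists2 C : R, 0 < C & forall f : I -> H, ell p w f ->
    [/\ act_cvg M f, ell p w (act M f) &
        (ell_norm p w (act M f) <= C%:E * ell_norm p w f)%E].
Proof.
move=> ep [C hC]; exists (`|C| + 1) => [|f fp]; first by rewrite ltr_wpDl.
have [cv fM le] := hC f fp; split=> //; apply: le_trans le _.
rewrite lee_wpmul2r ?ell_norm_ge0 // lee_fin.
by rewrite (le_trans (ler_norm _)) // lerDl.
Qed.

Lemma actB M f g : A M -> act_cvg M f -> act_cvg M g ->
  act M (f - g) = act M f - act M g.
Proof.
move=> AM cf cg; apply/funext => k; have [s hs] := cf k; have [t ht] := cg k.
rewrite /act; apply: (usumE exh).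
have -> : (fun l => M k l ((f - g) l)) = (fun l => M k l (f l) - M k l (g l)).
  by apply/funext => l; rewrite -(bopB (sa_entries salg AM k l)).
by apply: usum_toB; rewrite ?(usumE exh hs) ?(usumE exh ht).
Qed.

(** Only p = 0 needs an argument. The estimate is that of p = +oo. A finitely supported [g] lies in
    l^1, so [act M g] does too, and its truncations converge to it in l^1, hence uniformly with
    weight; approximating [f] by such [g] and using closedness of l^0 concludes. *)
Lemma bounded_on_admissible (M : mx H I) (p : \bar R) : A M ->
  (p0%:E < p)%E \/ p = 0%E \/ p = 1%E ->
  exists2 C : R, 0 < C & forall f : I -> H, ell p w f ->
    [/\ act_cvg M f, ell p w (act M f) &
        (ell_norm p w (act M f) <= C%:E * ell_norm p w f)%E].
Proof.
move=> AM [p0p|[->|->]].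
- apply: bounded_on_pos; last by apply: adm => //; left.
  by right; apply: lt_trans p0p; rewrite lte_fin.
- have eo : exponent (+oo : \bar R) by right.
  have e0 : exponent (0 : \bar R) by left.
  have e1 : exponent (1 : \bar R) by right; rewrite lte_fin.
  have oo : (p0%:E < +oo)%E by exact: ltry.
  have [C C0 hC] := bounded_on_pos eo (adm AM (or_introl oo)).
  have [C1 hC1] := adm AM (or_intror (erefl (1%E : \bar R))).
  have ell0oo (f : I -> H) : ell 0%E w f -> ell +oo%E w f.
    by rewrite /ell /= eqxx => -[].
  exists C => // f f0; have fo := ell0oo _ f0.
  have [cf af le] := hC f fo; split; [exact: cf| |by rewrite !ell_norm_zero].
  have act00 g : @ell00 R H I g -> ell 0%E w (act M g).
    move=> g00; have [_ a1 _] := hC1 _ (ell_ell00 w_gt0 e1 g00).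
    apply: (ell_closed w_gt0 e0) => e e_gt0.
    have e2 : 0 < e / 2 by rewrite divr_gt0.
    have [G hG] := ell_trunc w_gt0 e1 (ltry _) a1 e2.
    exists (trunc G (act M g)).
      by apply: ell_ell00 => //; exact: ell00_trunc.
    apply: (@le_lt_trans _ _ (e / 2)%:E); last by rewrite lte_fin; lra.
    apply/(ell_norm_leP _ _ e0 (ltW e2)) => G'.
    apply: fnorm_sup_le; [by rewrite eqxx|exact: ltW|].
    move=> k _; rewrite -lee_fin; apply: le_trans (hG G (fsubset_refl _)).
    exact: wgt_le_ell_norm.
  apply: (ell_closed w_gt0 e0) => e e_gt0.
  have eC : 0 < e / C by rewrite divr_gt0.
  move: f0; rewrite {1}/ell /= eqxx => -[_ /(_ _ eC) [g g00 fg]].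
  exists (act M g); first exact: act00.
  have go := ell_ell00 w_gt0 eo g00.
  have [cg _ _] := hC _ go.
  rewrite -actB // ell_norm_zero.
  have [_ _ le'] := hC _ (ellB w_gt0 eo fo go).
  apply: le_lt_trans le' _.
  rewrite (@lt_le_trans _ _ (C%:E * (e / C)%:E)%E) //.
    by rewrite lte_pmul2l ?lte_fin.
  by rewrite -EFinM lee_fin mulrC divfK // gt_eqF.
- apply: bounded_on_pos; last by apply: adm => //; right.
  by right; rewrite lte_fin.
Qed.

(** Ordered on purpose: [U] analyzes, [W] synthesizes, and the Gram matrix of [W] turns
    [U]-coefficients into [W]-coefficients. *)
Definition dual_pair (U W : I -> H -> H) := [/\ forall k, bounded_op (U k),
  forall k, bounded_op (W k), A (gram dot W W) &
  forall f, usum_to (fun k => adj dot (W k) (U k f)) f].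

Definition fsynth (W : I -> H -> H) (G : {fset I}) (c : I -> H) : H :=
  \sum_(k <- G) adj dot (W k) (c k).

(** Valid for every [f] in H: convergence comes from the expansion of [f] in H and the continuity of
    [W k], and the truncated part contributes a finite sum. *)
Lemma dual_pair_usum U W f c G k : dual_pair U W ->
  usum_to (fun l => gram dot W W k l (U l f - trunc G c l))
    (W k (f - fsynth W G c)).
Proof.
move=> [bU bW AW D].
have bG := sa_entries salg AW k.
have -> : (fun l => gram dot W W k l (U l f - trunc G c l)) =
    (fun l => gram dot W W k l (U l f) - gram dot W W k l (trunc G c l)).
  by apply/funext => l; rewrite (bopB (bG l)).
rewrite (bopB (bW k)); apply: usum_toB.
  exact: (usum_to_bop (bW k) (D f)).
have -> : W k (fsynth W G c) = \sum_(l <- G) gram dot W W k l (trunc G c l).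
  rewrite /fsynth (bop_sum (bW k)) big_seq [RHS]big_seq.
  by apply: eq_bigr => l lG; rewrite /trunc lG.
by apply: usum_to_fset => l lG; rewrite truncE // (bop0 (bG l)).
Qed.

(** One estimate with several uses: [G] empty compares the two norms, [f = 0] shows that finite
    syntheses have finite norm, and the general case controls the error of partial sums. *)
Lemma dual_pair_bound U W (p : \bar R) : dual_pair U W ->
  (p0%:E < p)%E \/ p = 0%E \/ p = 1%E ->
  exists2 C : R, 0 < C & forall f c G, ell p w (analysis U f - trunc G c) ->
    ell p w (analysis W (f - fsynth W G c)) /\
    (ell_norm p w (analysis W (f - fsynth W G c)%R) <=
       C%:E * ell_norm p w (analysis U f - trunc G c)%R)%E.
Proof.
move=> UW hp; have [_ _ AW _] := UW; have [C C0 hC] := bounded_on_admissible AW hp.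
exists C => // f c G hf; have [_ a1 a2] := hC _ hf.
have <- : act (gram dot W W) (analysis U f - trunc G c) =
    analysis W (f - fsynth W G c).
  by apply/funext => k; apply: (usumE exh); exact: dual_pair_usum.
by [].
Qed.

End Algebra.

Lemma ecvg0P (R : realType) (a : nat -> \bar R) : (forall n, (0 <= a n)%E) ->
  a n @[n --> \oo] --> 0%E <->
  (forall e : R, 0 < e -> exists N, forall n, (N <= n)%N -> (a n < e%:E)%E).
Proof.
move=> a0; split=> [/fine_cvgP[[N1 _ h1] /cvgrPdist_lt h] e e0|h].
  have [N2 _ h2] := h e e0; exists (maxn N1 N2) => n.
  rewrite geq_max => /andP[/h1 /= fn /h2 /=].
  by rewrite sub0r normrN -(fineK fn) lte_fin; apply: le_lt_trans; exact: ler_norm.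
apply/fine_cvgP; split.
  have [N hN] := h _ ltr01; exists N => // n /hN /= an.
  by rewrite ge0_fin_numE // (lt_trans an) // ltry.
apply/cvgrPdist_lt => e e0; have [N hN] := h _ e0; exists N => // n /hN /= an.
have fn : a n \is a fin_num by rewrite ge0_fin_numE // (lt_trans an) // ltry.
by rewrite sub0r normrN ger0_norm ?fine_ge0 // -lte_fin fineK.
Qed.

(** * Completions as classes of Cauchy sequences *)

Section CauchyClasses.
Context {R : realType} {H : completeNormedModType R[i]} {I : choiceType}.
Variables (w : I -> R) (p : \bar R).
Hypothesis w_gt0 : forall k, 0 < w k.
Hypothesis ep : exponent p.

Section OneSystem.
Variable U : I -> H -> H.
Hypothesis bU : forall k, bounded_op (U k).
Implicit Types (f g : H) (u v : nat -> H) (x : set (nat -> H)).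

Lemma analysisB f g : analysis U (f - g) = analysis U f - analysis U g.
Proof. by apply/funext => k; rewrite /analysis (bopB (bU k)). Qed.

Lemma analysisD f g : analysis U (f + g) = analysis U f + analysis U g.
Proof. by apply/funext => k; rewrite /analysis (bopD (bU k)). Qed.

Lemma analysis0 : analysis U 0 = 0.
Proof. by apply/funext => k; rewrite /analysis (bop0 (bU k)). Qed.

Lemma qnorm_ge0 f : (0 <= qnorm w p U f)%E.
Proof. exact: ell_norm_ge0. Qed.

Lemma qnormC f g : qnorm w p U (f - g) = qnorm w p U (g - f).
Proof. by rewrite /qnorm !analysisB -opprB ell_normN. Qed.

Lemma qnorm0 : qnorm w p U 0 = 0%E.
Proof. by rewrite /qnorm analysis0 ell_norm0. Qed.

Lemma qnorm_small (e : R) : 0 < e -> exists2 d, 0 < d & forall g f h,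
  (qnorm w p U (f - g)%R <= d%:E -> qnorm w p U (g - h)%R <= d%:E ->
   qnorm w p U (f - h)%R < e%:E)%E.
Proof.
move=> e0; have [d d0 hd] := ell_norm_small (H := H) w_gt0 ep e0.
exists d => // g f h fg gh.
by rewrite -(subrKA g) /qnorm analysisD hd.
Qed.

Lemma VspaceB f g : Vspace w p U f -> Vspace w p U g -> Vspace w p U (f - g).
Proof. by rewrite /Vspace /= analysisB; apply: ellB. Qed.

Lemma qnorm_fin f : Vspace w p U f -> qnorm w p U f \is a fin_num.
Proof.
by move=> Vf; have [c c0 cE] := ell_norm_fin ep Vf; rewrite /qnorm cE.
Qed.

(** There is no reverse triangle inequality for a quasi-norm. The almost triangle inequality gives
    [a n <= (1 + e) * a m + e] for late indices; this bounds [a] first (with [e = 1]), and then the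
    excess [e * a m] is small. *)
Lemma qnorm_cvg u : cauchy_in w p U u ->
  exists l : R, qnorm w p U (u n) @[n --> \oo] --> l%:E.
Proof.
move=> [Vu uC]; pose a n := fine (qnorm w p U (u n)).
have aE n : (a n)%:E = qnorm w p U (u n) by rewrite /a fineK // qnorm_fin.
have a0 n : 0 <= a n by rewrite fine_ge0 // qnorm_ge0.
have key (e : R) : 0 < e -> exists2 C, 0 < C & forall m n,
    (qnorm w p U (u n - u m)%R < (e / C)%:E)%E -> a n <= (1 + e) * a m + e.
  move=> e0; have [C C0 hC] := ell_almost_triangle (H := H) w_gt0 ep e0.
  exists C => // m n nm; rewrite -lee_fin aE -[X in qnorm _ _ _ X](subrK (u m)).
  rewrite addrC /qnorm analysisD; apply: le_trans (hC _ _) _.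
  rewrite [leRHS]EFinD [X in (_ <= X + _)%E]EFinM aE leeD //.
  apply: (@le_trans _ _ (C%:E * (e / C)%:E)%E).
    by rewrite lee_pmul ?ell_norm_ge0 ?lee_fin ?(ltW C0) // ltW.
  by rewrite -EFinM lee_fin mulrC divfK // gt_eqF.
have [C1 C10 hC1] := key _ ltr01.
have [|N1 hN1] := uC (1 / C1); first by rewrite divr_gt0.
pose B := (1 + 1) * a N1 + 1.
have B0 : 0 < B by rewrite ltr_wpDl // mulr_ge0.
have aB n : (N1 <= n)%N -> a n <= B.
  by move=> nN; apply: hC1; exact: hN1.
have aC : cvg (a n @[n --> \oo]).
  apply: cauchy_cvg; apply: cauchy_exP => e e0.
  (* The error [e' * a m + e'] is then at most [e' * (B + 1) = e / 2]. *)
  pose e' := e / 2 / (B + 1).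
  have B1 : 0 < B + 1 by rewrite addr_gt0.
  have e'0 : 0 < e' by rewrite !divr_gt0.
  have [C C0 hC] := key _ e'0.
  have [|N hN] := uC (e' / C); first by rewrite divr_gt0.
  have hle m n : (maxn N N1 <= m)%N -> (maxn N N1 <= n)%N -> a n <= a m + e / 2.
    rewrite !geq_max => /andP[mN mN1] /andP[nN nN1].
    apply: le_trans (hC m n (hN _ _ nN mN)) _.
    rewrite mulrDl mul1r -addrA lerD2l -{2}[e']mulr1 -mulrDr.
    apply: (@le_trans _ _ (e' * (B + 1))).
      by rewrite ler_wpM2l ?(ltW e'0) // lerD2r aB.
    by rewrite /e' divfK // gt_eqF.
  exists (a (maxn N N1)), (maxn N N1) => // n /= nN.
  rewrite -ball_normE /= ltr_norml.
  have := hle _ _ nN (leqnn _); have := hle _ _ (leqnn _) nN.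
  by move=> h1 h2; apply/andP; split; lra.
exists (lim (a n @[n --> \oo])).
have -> : (fun n => qnorm w p U (u n)) = (fun n => (a n)%:E).
  by apply/funext => n; rewrite aE.
by apply: cvg_EFin => //; near=> n.
Unshelve. all: by end_near. Qed.

Lemma cauchy_inB u v : cauchy_in w p U u -> cauchy_in w p U v ->
  cauchy_in w p U (fun n => u n - v n).
Proof.
move=> [Vu uC] [Vv vC]; split=> [n|e e0]; first exact: VspaceB.
have [d d0 hd] := ell_norm_small (H := H) w_gt0 ep e0.
have [N1 h1] := uC _ d0; have [N2 h2] := vC _ d0; exists (maxn N1 N2) => m n.
rewrite !geq_max => /andP[m1 m2] /andP[n1 n2].
have -> : u m - v m - (u n - v n) = (u m - u n) + (v n - v m).
  by rewrite opprB [v n - u n]addrC addrACA [- v m + v n]addrC.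
rewrite /qnorm analysisD; apply: hd; apply: ltW; [exact: h1|exact: h2].
Qed.

Lemma cauchy_in_cst f : Vspace w p U f -> cauchy_in w p U (fun=> f).
Proof.
move=> Vf; split=> // e e0; exists 0%N => m n _ _.
by rewrite subrr qnorm0 lte_fin.
Qed.

Lemma cauchy_classP u v : cauchy_class w p U u v <-> cauchy_in w p U v /\
  forall e : R, 0 < e -> exists N, forall n, (N <= n)%N ->
    (qnorm w p U (u n - v n)%R < e%:E)%E.
Proof.
split=> -[cv h]; split=> //.
  by apply/ecvg0P => // n; exact: qnorm_ge0.
by apply/ecvg0P => // n; exact: qnorm_ge0.
Qed.

Lemma cauchy_class_refl u : cauchy_in w p U u -> cauchy_class w p U u u.
Proof.
move=> cu; apply/cauchy_classP; split=> // e e0; exists 0%N => n _.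
by rewrite subrr qnorm0 lte_fin.
Qed.

Lemma cauchy_class_sub u v : cauchy_class w p U u v ->
  cauchy_class w p U v `<=` cauchy_class w p U u.
Proof.
move=> /cauchy_classP[_ uv] x /cauchy_classP[cx vx]; apply/cauchy_classP; split=> // e e0.
have [d d0 hd] := qnorm_small e0.
have [N1 h1] := uv _ d0; have [N2 h2] := vx _ d0; exists (maxn N1 N2) => n.
rewrite geq_max => /andP[n1 n2].
by apply: (hd (v n)); [exact/ltW/h1|exact/ltW/h2].
Qed.

Lemma cauchy_class_eq u v : cauchy_in w p U u -> cauchy_class w p U u v ->
  cauchy_class w p U u = cauchy_class w p U v.
Proof.
move=> cu uv; rewrite eqEsubset; split; last exact: cauchy_class_sub.
apply: cauchy_class_sub; apply/cauchy_classP; split=> // e.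
by case/cauchy_classP: uv => _ h /h [N hN]; exists N => n /hN; rewrite qnormC.
Qed.

Lemma get_cauchy_class u : cauchy_in w p U u ->
  cauchy_class w p U u (get (cauchy_class w p U u)).
Proof. by move=> cu; exact: (getI (cauchy_class_refl cu)). Qed.

Lemma cauchy_in_cvg u k : cauchy_in w p U u -> cvg (U k (u n) @[n --> \oo]).
Proof.
move=> [_ uC]; apply: vcauchy_cvg => e e0.
have [|N hN] := uC (e * w k); first by rewrite mulr_gt0.
exists N => m n mN nN; rewrite -(bopB (bU k)) -(ltr_pM2r (w_gt0 k)) -lte_fin.
apply: le_lt_trans (hN _ _ mN nN).
exact: (wgt_le_ell_norm w_gt0 (analysis U (u m - u n)) k ep).
Qed.

(** [ext] reads its limit along the representative picked by [get]. As [w k > 0], the quasi-norm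
    controls each coordinate, so all representatives give the same limit. *)
Lemma cauchy_class_ext u v k : cauchy_in w p U u -> cauchy_class w p U u v ->
  U k (v n) @[n --> \oo] --> ext U (cauchy_class w p U u) k.
Proof.
move=> cu uv; set x := cauchy_class w p U u.
have xx : x (get x) by exact: get_cauchy_class.
have /cvg_ex[l hl] : cvg (U k (get x n) @[n --> \oo]).
  by apply: cauchy_in_cvg; exact: xx.1.
have -> : ext U x k = l by apply: cvg_lim => //; exact: norm_hausdorff.
have /cauchy_classP[_ h] : cauchy_class w p U (get x) v.
  by rewrite -(cauchy_class_eq cu xx).
have d0 : (U k (get x n) - U k (v n)) @[n --> \oo] --> (0 : H).
  apply/vcvg0P => e e0; have [|N hN] := h (e * w k); first by rewrite mulr_gt0.
  exists N => n /hN; rewrite -(bopB (bU k)) -(ltr_pM2r (w_gt0 k)) -lte_fin.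
  apply: le_lt_trans.
  exact: (wgt_le_ell_norm w_gt0 (analysis U (get x n - v n)) k ep).
have hlim := cvgB hl d0; rewrite subr0 in hlim.
have -> : (fun n => U k (v n)) =
    (fun n => U k (get x n)) - (fun n => U k (get x n) - U k (v n)).
  apply/funext => n.
  by change (U k (v n) = U k (get x n) - (U k (get x n) - U k (v n))); rewrite subKr.
exact: hlim.
Qed.

Lemma cauchy_class_ext_wd u : cauchy_in w p U u -> ext_wd U (cauchy_class w p U u).
Proof. by move=> cu v uv k; exact: cauchy_class_ext. Qed.

(** The Fatou lemma, applied to [u m - u n] as [n] grows, upgrades coordinatewise convergence to
    convergence in l^p. *)
Lemma ext_approx u (e : R) : cauchy_in w p U u -> 0 < e ->
  exists N, forall m, (N <= m)%N ->
  (ell_norm p w (analysis U (u m) - ext U (cauchy_class w p U u))%R <= e%:E)%E.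
Proof.
move=> cu e0; have [N hN] := cu.2 _ e0; exists N => m mN.
apply: (ell_norm_fatou w_gt0 (u := fun n => analysis U (u m) - analysis U (u n))
          ep (ltW e0)).
  move=> k; apply: cvgB; first exact: cvg_cst.
  by apply: cauchy_class_ext => //; exact: cauchy_class_refl.
by exists N => n nN; rewrite -analysisB ltW // hN.
Qed.

Lemma ext_ell u : cauchy_in w p U u -> ell p w (ext U (cauchy_class w p U u)).
Proof.
move=> cu; apply: (ell_closed w_gt0 ep) => e e0.
have e2 : 0 < e / 2 by rewrite divr_gt0.
have [N hN] := ext_approx cu e2; exists (analysis U (u N)); first exact: cu.1.
rewrite -ell_normN // opprB; apply: le_lt_trans (hN _ (leqnn _)) _.
by rewrite lte_fin; lra.
Qed.

(** [Hdist] compares unknown representatives chosen by [get]; passing from them to [s n] and [u m]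
    takes two quasi-triangle steps, which is why [d] and then [d'] are prepared. *)
Lemma Hdist_cvg0 u (s : nat -> H) : cauchy_in w p U u ->
  (forall n, Vspace w p U (s n)) ->
  (forall e : R, 0 < e -> exists N, forall n, (N <= n)%N ->
     exists M, forall m, (M <= m)%N -> (qnorm w p U (s n - u m)%R < e%:E)%E) ->
  Hdist w p U (embed w p U (s n)) (cauchy_class w p U u) @[n --> \oo] --> 0%E.
Proof.
move=> cu Vs hs; set x := cauchy_class w p U u.
have xx : x (get x) by exact: get_cauchy_class.
pose y n := embed w p U (s n).
have cs n := cauchy_in_cst (Vs n).
have yy n : y n (get (y n)) by exact: get_cauchy_class.
have lE n : exists2 l : R, Hdist w p U (y n) x = l%:E &
    qnorm w p U (get (y n) m - get x m) @[m --> \oo] --> l%:E.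
  have [l hl] := qnorm_cvg (cauchy_inB (yy n).1 xx.1).
  by exists l => //; apply: cvg_lim.
have le_lim n (e : R) : (exists M, forall m, (M <= m)%N ->
    (qnorm w p U (get (y n) m - get x m)%R <= e%:E)%E) ->
    (0 <= Hdist w p U (y n) x <= e%:E)%E.
  move=> [M hM]; have [l -> hl] := lE n; apply/andP; split.
    by apply: (cvge_ge _ hl); near=> m; exact: qnorm_ge0.
  by apply: (cvge_le _ hl); exists M.
have main (e : R) : 0 < e -> exists N, forall n, (N <= n)%N ->
    (0 <= Hdist w p U (y n) x <= e%:E)%E.
  move=> e0; have [d d0 hd] := qnorm_small e0.
  have [d' d'0 hd'] := qnorm_small d0.
  have [N hN] := hs _ d'0; exists N => n /hN [M1 h1]; apply: le_lim.
  have /cauchy_classP[_ /(_ _ d0) [M2 h2]] := yy n.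
  have /cauchy_classP[_ /(_ _ d'0) [M3 h3]] := xx.
  exists (maxn M1 (maxn M2 M3)) => m; rewrite !geq_max => /and3P[m1 m2 m3].
  apply/ltW/(hd (s n)); first by rewrite qnormC; exact/ltW/h2.
  by apply/ltW/(hd' (u m)); [exact/ltW/h1|exact/ltW/h3].
apply/ecvg0P => [n|e e0].
  have [l -> hl] := lE n.
  by apply: (cvge_ge _ hl); near=> m; exact: qnorm_ge0.
have e2 : 0 < e / 2 by rewrite divr_gt0.
have [N hN] := main _ e2; exists N => n /hN /andP[_ h].
by apply: le_lt_trans h _; rewrite lte_fin; lra.
Unshelve. all: by end_near. Qed.

End OneSystem.

Definition dominates (U W : I -> H -> H) := exists2 C : R, 0 < C &
  forall f, Vspace w p U f -> Vspace w p W f /\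
    (qnorm w p W f <= C%:E * qnorm w p U f)%E.

Section TwoSystems.
Variables U W : I -> H -> H.
Hypothesis bU : forall k, bounded_op (U k).
Hypothesis bW : forall k, bounded_op (W k).
Hypothesis UW : dominates U W.

Lemma dominates_small (e : R) : 0 < e -> exists2 d, 0 < d &
  forall f, Vspace w p U f -> (qnorm w p U f < d%:E -> qnorm w p W f < e%:E)%E.
Proof.
move=> e0; have [C C0 hC] := UW; exists (e / C) => [|f Vf lt]; first by rewrite divr_gt0.
apply: le_lt_trans (hC f Vf).2 _.
rewrite (@lt_le_trans _ _ (C%:E * (e / C)%:E)%E) //.
  by rewrite lte_pmul2l ?lte_fin.
by rewrite -EFinM lee_fin mulrC divfK // gt_eqF.
Qed.

Lemma dominates_Vspace f : Vspace w p U f -> Vspace w p W f.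
Proof. by move=> Vf; have [C _ hC] := UW; exact: (hC f Vf).1. Qed.

Lemma dominates_cauchy u : cauchy_in w p U u -> cauchy_in w p W u.
Proof.
move=> [Vu uC]; split=> [n|e e0]; first exact: dominates_Vspace.
have [d d0 hd] := dominates_small e0; have [N hN] := uC _ d0.
exists N => m n mN nN; apply: hd; first exact: VspaceB.
exact: hN.
Qed.

Lemma dominates_class u : cauchy_in w p U u ->
  cauchy_class w p U u `<=` cauchy_class w p W u.
Proof.
move=> cu v /cauchy_classP[cv uv]; apply/cauchy_classP; split.
  exact: dominates_cauchy.
move=> e e0; have [d d0 hd] := dominates_small e0; have [N hN] := uv _ d0.
exists N => n /hN; apply: hd; apply: VspaceB => //; [exact: cu.1|exact: cv.1].
Qed.

(** Both norms are evaluated on the same set of sequences, hence along the same representative, and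
    the pointwise inequality passes to the limit. *)
Lemma dominates_Hnorm : exists2 C : R, 0 < C &
  forall u, cauchy_in w p U u -> (Hnorm w p W (cauchy_class w p U u) <=
     C%:E * Hnorm w p U (cauchy_class w p U u))%E.
Proof.
have [C C0 hC] := UW; exists C => // u cu; rewrite /Hnorm.
have [cv _] := get_cauchy_class bU cu; set v := get _ in cv *.
have [l hl] := qnorm_cvg bU cv.
have [l' hl'] := qnorm_cvg bW (dominates_cauchy cv).
rewrite (cvg_lim _ hl) // (cvg_lim _ hl') //.
rewrite -EFinM lee_fin.
move: hl hl' => /fine_cvgP[_ hl] /fine_cvgP[_ hl'].
apply: (ler_cvg_to hl' (cvgM (cvg_cst C) hl)).
near=> n; have [VW le] := hC _ (cv.1 n).
rewrite /= -lee_fin EFinM !fineK //; first exact: qnorm_fin (cv.1 n).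
exact: qnorm_fin VW.
Unshelve. all: by end_near. Qed.

End TwoSystems.

End CauchyClasses.

(** * Co-orbit spaces for [p < +oo] *)

Section CoorbitFinite.
Context {R : realType} {H : completeNormedModType R[i]} {I : choiceType}.
Variables (dot : {dot H for Num.conj}) (A : set (mx H I)) (nA : mx H I -> R).
Variables (p0 : R) (w : I -> R) (p : \bar R).
Hypothesis exh : exists F : nat -> {fset I}, exhaustion F.
Hypothesis hilb : is_hilbert dot.
Hypothesis salg : spectral_algebra dot A nA.
Hypothesis p0_gt0 : 0 < p0.
Hypothesis w_gt0 : forall k, 0 < w k.
Hypothesis adm : admissible A p0 w.
Hypothesis hp : (p0%:E < p)%E \/ p = 0%E \/ p = 1%E.
Implicit Types U W : I -> H -> H.

Lemma exponent_admissible : exponent p.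
Proof.
case: hp => [p0p|[->|->]]; [right|by left|by right; rewrite lte_fin].
by apply: lt_trans p0p; rewrite lte_fin.
Qed.
Let ep := exponent_admissible.

Lemma fsynth_fset0 W c : fsynth dot W fset0 c = 0.
Proof. by rewrite /fsynth big_seq_fset0. Qed.

Lemma trunc_fset0 (c : I -> H) : trunc fset0 c = 0.
Proof. by apply/funext => k; rewrite truncE. Qed.

Lemma dual_pair_dominates U W : dual_pair dot A U W -> dominates w p U W.
Proof.
move=> UW; have [C C0 hC] := dual_pair_bound exh salg p0_gt0 w_gt0 adm UW hp.
exists C; [exact: C0|move=> f Vf]; have := hC f 0 fset0.
by rewrite fsynth_fset0 trunc_fset0 !subr0; apply.
Qed.

Lemma fsynth_Vspace U W G c : dual_pair dot A U W -> Vspace w p W (fsynth dot W G c).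
Proof.
move=> UW; have [bU bW _ _] := UW.
have [C C0 hC] := dual_pair_bound exh salg p0_gt0 w_gt0 adm UW hp.
have [|h _] := hC 0 c G.
  rewrite (analysis0 bU) sub0r; apply: ellN => //.
  by apply: ell_ell00 => //; exact: ell00_trunc.
move: h; rewrite sub0r => h; rewrite /Vspace /=.
have -> : analysis W (fsynth dot W G c) = - analysis W (- fsynth dot W G c).
  by apply/funext => k; rewrite /analysis /GRing.opp /= (bopN (bW k)) opprK.
exact: ellN.
Qed.

Lemma synthesis_trunc W G c : (forall k, bounded_op (W k)) ->
  synthesis dot W (trunc G c) = fsynth dot W G c.
Proof.
move=> bW; rewrite /synthesis (@fsbigTE _ _ _ _ G) => [|k kG].
  by rewrite /fsynth big_seq [RHS]big_seq; apply: eq_bigr => k kG; rewrite /trunc kG.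
rewrite truncE //; apply: adj_at0 => //.
exact: (adjP exh hilb salg k (bW k)).
Qed.

Lemma H00_fsynth W G c : (forall k, bounded_op (W k)) -> H00 dot W (fsynth dot W G c).
Proof.
by move=> bW; exists (trunc G c); [exact: ell00_trunc|exact: synthesis_trunc].
Qed.

Lemma H00P W f : (forall k, bounded_op (W k)) -> H00 dot W f ->
  exists G c, f = fsynth dot W G c.
Proof.
move=> bW [c /ell00P[G hG] <-]; exists G, c; rewrite -synthesis_trunc //.
congr synthesis; apply/funext => k; rewrite /trunc.
by case: ifPn => // /hG.
Qed.

(** With [c] the extended coefficients, the error at [u m] is governed by [analysis U (u m) - c],
    small for late [m], plus [c - trunc (F n) c], small for late [n]. The estimate lands in the
    [W]-norm because [dual_pair_bound] goes from [U] to [W]. *)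
Lemma fsynth_approx U W u (F : nat -> {fset I}) (e : R) :
  (p < +oo)%E -> dual_pair dot A U W -> cauchy_in w p U u -> exhaustion F -> 0 < e ->
  exists N, forall n, (N <= n)%N -> exists M, forall m, (M <= m)%N ->
    (qnorm w p W (fsynth dot W (F n) (ext U (cauchy_class w p U u)) - u m)%R < e%:E)%E.
Proof.
move=> poo UW cu eF e0; have [bU bW _ _] := UW.
have [C C0 hC] := dual_pair_bound exh salg p0_gt0 w_gt0 adm UW hp.
set c := ext U _; have cp : ell p w c by exact: ext_ell.
have eC : 0 < e / C by rewrite divr_gt0.
have [d d0 hd] := ell_norm_small (H := H) w_gt0 ep eC.
have [G hG] := ell_trunc w_gt0 ep poo cp d0.
have [N hN] := exhaustion_sub G eF.
have [M hM] := ext_approx w_gt0 ep bU cu d0.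
exists N => n /hN /hG cn; exists M => m /hM um.
rewrite (qnormC w_gt0 ep bW).
have uc : analysis U (u m) - trunc (F n) c =
    (analysis U (u m) - c) + (c - trunc (F n) c) by rewrite subrKA.
have Lu : ell p w (analysis U (u m) - trunc (F n) c).
  apply: (ellB w_gt0 ep); first exact: cu.1.
  by apply: ell_ell00 => //; exact: ell00_trunc.
apply: le_lt_trans (hC _ _ _ Lu).2 _.
rewrite (@lt_le_trans _ _ (C%:E * (e / C)%:E)%E) //.
  by rewrite lte_pmul2l ?lte_fin // uc hd.
by rewrite -EFinM lee_fin mulrC divfK // gt_eqF.
Qed.

(** The approximant is a partial sum of the expansion of [f], seen as a constant Cauchy sequence;
    the reverse pair returns from the [W]-norm to the [U]-norm. *)
Lemma H00_dense U W f (e : R) : (p < +oo)%E -> dual_pair dot A U W ->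
  dual_pair dot A W U -> Vspace w p U f -> 0 < e ->
  exists g, [/\ H00 dot W g, Vspace w p U g & (qnorm w p U (f - g)%R < e%:E)%E].
Proof.
move=> poo UW WU Vf e0; have [bU bW _ _] := UW.
have WdU := dual_pair_dominates WU; have UdW := dual_pair_dominates UW.
have [d d0 hd] := dominates_small WdU e0.
have [F eF] := exh; have cf := cauchy_in_cst w_gt0 ep bU Vf.
have [N /(_ _ (leqnn _)) [M /(_ _ (leqnn _)) h]] := fsynth_approx poo UW cf eF d0.
set g := fsynth _ _ _ _ in h; have Vg : Vspace w p W g by exact: (fsynth_Vspace _ _ UW).
exists g; split; [exact: H00_fsynth|exact: (dominates_Vspace WdU)|].
apply: hd; first exact: (VspaceB w_gt0 ep bW (dominates_Vspace UdW Vf) Vg).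
by rewrite (qnormC w_gt0 ep bW).
Qed.

(** By density, each [u n] can be moved into [H00 dot W] at cost [1 / (n + 1)]. The completions of
    [H00] and of [Vspace] thus agree, and the right side mentions [U] alone. *)
Lemma HspaceE U W : (p < +oo)%E -> dual_pair dot A U W -> dual_pair dot A W U ->
  Hspace dot w p U W = [set cauchy_class w p U u | u in cauchy_in w p U].
Proof.
move=> poo UW WU; have [bU bW _ _] := UW; rewrite eqEsubset; split.
  by move=> _ [u [cu _] <-]; exists u.
move=> _ [u cu <-].
have inv_gt0 n : 0 < (n.+1%:R : R)^-1 by rewrite invr_gt0 ltr0n.
have [g hg] := boolp.choice (fun n => H00_dense poo UW WU (cu.1 n) (inv_gt0 n)).
have ug (e : R) : 0 < e -> exists N, forall n, (N <= n)%N ->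
    (qnorm w p U (u n - g n)%R < e%:E)%E.
  move=> e0; have [N _ hN] := near_infty_natSinv_lt (PosNum e0).
  exists N => n /hN /= ne; have [_ _ /lt_le_trans] := hg n; apply.
  by rewrite lee_fin ltW.
have cg : cauchy_in w p U g.
  split=> [n|e e0]; first by have [] := hg n.
  have [d d0 hd] := qnorm_small w_gt0 ep bU e0.
  have [d' d'0 hd'] := qnorm_small w_gt0 ep bU d0.
  have [N1 h1] := ug _ d'0; have [N2 h2] := cu.2 _ d'0.
  have [N3 h3] := ug _ d0.
  exists (maxn N1 (maxn N2 N3)) => m n.
  rewrite !geq_max => /and3P[m1 m2 m3] /and3P[n1 n2 n3].
  apply: (hd (u n)); last exact/ltW/h3.
  apply/ltW/(hd' (u m)); last exact/ltW/h2.
  by rewrite (qnormC w_gt0 ep bU); exact/ltW/h1.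
exists g; first by split=> // n; have [] := hg n.
apply/esym; apply: cauchy_class_eq => //.
by apply/cauchy_classP.
Qed.

(** Equivalent quasi-norms have the same Cauchy sequences and the same null differences, so the
    classes coincide as sets. *)
Lemma cauchy_class_dual U W u : dual_pair dot A U W -> dual_pair dot A W U ->
  cauchy_in w p U u -> cauchy_in w p W u /\
  cauchy_class w p U u = cauchy_class w p W u.
Proof.
move=> UW WU cu; have [bU bW _ _] := UW.
have WdU := dual_pair_dominates WU; have UdW := dual_pair_dominates UW.
have cW := dominates_cauchy w_gt0 ep bU UdW cu; split; first exact: cW.
by rewrite eqEsubset; split; exact: dominates_class.
Qed.

Lemma Hspace_dual U W : (p < +oo)%E -> dual_pair dot A U W ->
  dual_pair dot A W U -> Hspace dot w p U W = Hspace dot w p W U.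
Proof.
move=> poo UW WU; rewrite (HspaceE poo UW WU) (HspaceE poo WU UW).
rewrite eqEsubset; split=> _ [u cu <-].
  by have [cW ->] := cauchy_class_dual UW WU cu; exists u.
by have [cW ->] := cauchy_class_dual WU UW cu; exists u.
Qed.

Lemma Vspace_dual U W : dual_pair dot A U W -> dual_pair dot A W U ->
  Vspace w p U = Vspace w p W.
Proof.
move=> UW WU; rewrite eqEsubset; split=> f.
  exact: (dominates_Vspace (dual_pair_dominates UW)).
exact: (dominates_Vspace (dual_pair_dominates WU)).
Qed.

(** [fsynth_approx] controls the [W]-norm of the error while [Hdist] uses the [U]-norm; [WdU] makes
    the passage. *)
Lemma Hspace_sum_to_dual U W u : (p < +oo)%E -> dual_pair dot A U W ->
  dual_pair dot A W U -> cauchy_in w p U u ->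
  Hspace_sum_to dot w p U W
    (fun k => adj dot (W k) (ext U (cauchy_class w p U u) k)) (cauchy_class w p U u).
Proof.
move=> poo UW WU cu F eF; have [bU bW _ _] := UW.
have WdU := dual_pair_dominates WU; have UdW := dual_pair_dominates UW.
have Vs n : Vspace w p U (fsynth dot W (F n) (ext U (cauchy_class w p U u))).
  by apply: (dominates_Vspace WdU); exact: (fsynth_Vspace _ _ UW).
split=> [n|].
  rewrite (HspaceE poo UW WU);
  exists (fun=> fsynth dot W (F n) (ext U (cauchy_class w p U u)));
    last reflexivity.
  exact: (cauchy_in_cst w_gt0 ep bU (Vs n)).
apply: (Hdist_cvg0 w_gt0 ep bU cu Vs) => e e0.
have [d d0 hd] := dominates_small WdU e0.
have [N hN] := fsynth_approx poo UW cu eF d0; exists N => n /hN [M hM].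
exists M => m /hM h; apply: (hd _ _ h); apply: (VspaceB w_gt0 ep bW).
  exact: (dominates_Vspace UdW).
by apply: (dominates_Vspace UdW); exact: cu.1.
Qed.

(* The norms of W and U being equivalent, the partial sums may be measured with
   either of them. *)
Lemma Hspace_sum_to_swap U W u : (p < +oo)%E -> dual_pair dot A U W ->
  dual_pair dot A W U -> cauchy_in w p U u ->
  Hspace_sum_to dot w p U W
    (fun k => adj dot (U k) (ext W (cauchy_class w p U u) k)) (cauchy_class w p U u).
Proof.
move=> poo UW WU cu F eF; have [bU bW _ _] := UW.
have [cW E] := cauchy_class_dual UW WU cu.
have Vs n : Vspace w p U (fsynth dot U (F n) (ext W (cauchy_class w p U u))).
  exact: (fsynth_Vspace _ _ WU).
split=> [n|].
  rewrite (HspaceE poo UW WU);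
  exists (fun=> fsynth dot U (F n) (ext W (cauchy_class w p U u)));
    last reflexivity.
  exact: (cauchy_in_cst w_gt0 ep bU (Vs n)).
apply: (Hdist_cvg0 w_gt0 ep bU cu Vs) => e e0.
by rewrite E; exact: (fsynth_approx poo WU cW eF e0).
Qed.

Lemma equiv_norms_of_le (E : Type) (S : set E) (N1 N2 : E -> \bar R) (C1 C2 : R) :
  0 < C1 -> 0 < C2 ->
  (forall x, S x -> (N2 x <= C1%:E * N1 x)%E) ->
  (forall x, S x -> (N1 x <= C2%:E * N2 x)%E) -> equiv_norms S N1 N2.
Proof.
move=> C10 C20 h1 h2; exists C2^-1, C1; split; rewrite ?invr_gt0 // => x Sx.
split; last exact: h1.
by rewrite muleC lee_pdivrMr // muleC; exact: h2.
Qed.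

Theorem coorbit_dual_finite U W : (p < +oo)%E ->
  dual_pair dot A U W -> dual_pair dot A W U ->
  [/\ Vspace w p U = Vspace w p W,
      equiv_norms (Vspace w p U) (qnorm w p U) (qnorm w p W),
      Hspace dot w p U W = Hspace dot w p W U,
      equiv_norms (Hspace dot w p U W) (Hnorm w p U) (Hnorm w p W) &
      forall f, Hspace dot w p U W f ->
        [/\ ext_wd U f, ext_wd W f,
            Hspace_sum_to dot w p U W (fun k => adj dot (W k) (ext U f k)) f &
            Hspace_sum_to dot w p U W (fun k => adj dot (U k) (ext W f k)) f]].
Proof.
move=> poo UW WU; have [bU bW _ _] := UW.
have WdU := dual_pair_dominates WU; have UdW := dual_pair_dominates UW.
have Veq := Vspace_dual UW WU.
split; first exact: Veq.
- have [C1 C10 h1] := UdW; have [C2 C20 h2] := WdU.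
  apply: (equiv_norms_of_le C10 C20) => f Vf; first exact: (h1 f Vf).2.
  by apply: (h2 f _).2; rewrite -Veq.
- exact: (Hspace_dual poo UW WU).
- have [C1 C10 h1] := dominates_Hnorm w_gt0 ep bU bW UdW.
  have [C2 C20 h2] := dominates_Hnorm w_gt0 ep bW bU WdU.
  rewrite (HspaceE poo UW WU); apply: (equiv_norms_of_le C10 C20) => _ [u cu <-].
    exact: h1.
  by have [cW ->] := cauchy_class_dual UW WU cu; exact: h2.
- rewrite (HspaceE poo UW WU) => _ [u cu <-]; have [cW E] := cauchy_class_dual UW WU cu.
  split; [exact: cauchy_class_ext_wd| |exact: Hspace_sum_to_dual|
          exact: Hspace_sum_to_swap].
  by rewrite E; exact: cauchy_class_ext_wd.
Qed.

End CoorbitFinite.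

Lemma ereal_sup_ltyP (R : realType) (a : nat -> \bar R) : (forall n, (0 <= a n)%E) ->
  (ereal_sup (range a) < +oo)%E <->
  exists2 B : R, 0 <= B & forall n, (a n <= B%:E)%E.
Proof.
move=> a0; split=> [h|[B B0 hB]].
  have h0 n : (a n <= ereal_sup (range a))%E by apply: ereal_sup_ubound; exists n.
  have s0 : (0 <= ereal_sup (range a))%E := le_trans (a0 0%N) (h0 0%N).
  have fs : ereal_sup (range a) \is a fin_num by rewrite ge0_fin_numE.
  by exists (fine (ereal_sup (range a))) => [|n]; rewrite ?fine_ge0 ?fineK.
apply: le_lt_trans (ltry B); apply: ge_ereal_sup => _ [n _ <-]; exact: hB.
Qed.

Lemma lee_comb (R : realType) (B C D E : R) (a b : \bar R) :
  0 <= D -> 0 <= E -> (0 <= a)%E -> (0 <= b)%E ->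
  (a <= B%:E -> b <= C%:E -> D%:E * a + E%:E * b <= (D * B + E * C)%:E)%E.
Proof.
by move=> D0 E0 a0 b0 aB bC; rewrite [leRHS]EFinD !EFinM leeD // lee_pmul.
Qed.

(** * Continuity of the inner product *)

Section DotContinuity.
Context {R : realType} {H : completeNormedModType R[i]}.
Variable dot : {dot H for Num.conj}.
Hypothesis hilb : is_hilbert dot.

Lemma cauchy_schwarz f g : vnorm (dot f g : (R[i])^o) <= vnorm f * vnorm g.
Proof.
have [->|g0] := eqVneq g 0.
  by rewrite linear0r vnorm0 mulr_ge0 ?vnorm_ge0.
have ng : 0 < `|g| by rewrite normr_gt0.
(* [a *: g] is the orthogonal projection of [f] onto the line of [g]; the inequality says that the
   residual has nonnegative square norm. *)
set z := dot f g; pose a := z / `|g| ^+ 2.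
have gf : dot g f = z^* by rewrite /z hermC expr0 mul1r.
have ra : `|g| ^+ 2 \is Num.real by rewrite realX // normr_real.
have ca : a^* = z^* / `|g| ^+ 2.
  by rewrite /a rmorphM fmorphV /= (CrealP ra).
have E : `|f - a *: g| ^+ 2 = `|f| ^+ 2 - `|z| ^+ 2 / `|g| ^+ 2.
  have dZl h k : dot (a *: h) k = a * dot h k by exact: linearZl_LR.
  have dZr h k : dot h (a *: k) = a^* * dot h k by exact: linearZr_LR.
  rewrite hilb linearBl /= !linearBr /= !dZl !dZr gf -/z -!hilb ca normCK /a.
  by field; rewrite gt_eqF.
have : 0 <= `|f - a *: g| ^+ 2 by rewrite exprn_ge0.
rewrite E subr_ge0 ler_pdivrMr ?exprn_gt0 // -exprMn.
rewrite ler_pXn2r ?nnegrE ?mulr_ge0 //.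
by rewrite -lecR rmorphM /= -!normE.
Qed.

Lemma cvg_dotl (u : nat -> H) f g : u n @[n --> \oo] --> f ->
  (dot (u n) g : (R[i])^o) @[n --> \oo] --> (dot f g : (R[i])^o).
Proof.
move=> uf; apply/vcvgP => e e0.
have g1 : 0 < vnorm g + 1 by rewrite ltr_wpDl ?vnorm_ge0.
have eg : 0 < e / (vnorm g + 1) by rewrite divr_gt0.
move/vcvgP: uf => /(_ _ eg) [N hN]; exists N => n /hN; rewrite ltr_pdivlMr // => le.
have -> : (dot f g : (R[i])^o) - dot (u n) g = dot (f - u n) g by rewrite linearBl.
apply: le_lt_trans (cauchy_schwarz _ _) _; apply: le_lt_trans le.
by rewrite ler_wpM2l ?vnorm_ge0 // lerDl.
Qed.

End DotContinuity.

(** * The case [p = +oo]: bounded sequences with coordinatewise limits *)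

Section CoorbitInfinite.
Context {R : realType} {H : completeNormedModType R[i]} {I : choiceType}.
Variables (dot : {dot H for Num.conj}) (A : set (mx H I)) (nA : mx H I -> R).
Variables (p0 : R) (w : I -> R).
Hypothesis exh : exists F : nat -> {fset I}, exhaustion F.
Hypothesis hilb : is_hilbert dot.
Hypothesis salg : spectral_algebra dot A nA.
Hypothesis p0_gt0 : 0 < p0.
Hypothesis w_gt0 : forall k, 0 < w k.
Hypothesis adm : admissible A p0 w.
Implicit Types (U W : I -> H -> H) (u v : nat -> H) (c : I -> H).

Let eo : exponent (+oo%E : \bar R). Proof. by right. Qed.
Let hoo : (p0%:E < +oo)%E \/ +oo%E = 0%E :> \bar R \/ +oo%E = 1%E :> \bar R.
Proof. by left; exact: ltry. Qed.

Lemma ell_oo_bound (f : I -> H) (B : R) : (ell_norm +oo w f <= B%:E)%E -> ell +oo w f.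
Proof. by move=> h; apply: le_lt_trans h _; exact: ltry. Qed.

(* Dominated convergence along a row: its entries are summable against 1/w. *)
Lemma row_cvg0 (M : mx H I) k (h : nat -> I -> H) (s : nat -> H) (B : R) :
  A M -> (forall n, (ell_norm +oo w (h n) <= B%:E)%E) ->
  (forall l, h n l @[n --> \oo] --> (0 : H)) ->
  (forall n, usum_to (fun l => M k l (h n l)) (s n)) ->
  s n @[n --> \oo] --> (0 : H).
Proof.
move=> AM hB h0 hs; have bM := sa_entries salg AM k.
have [S hS] := row_summable exh salg w_gt0 adm k AM.
have wB n l : wgt w (h n) l <= B.
  by rewrite -lee_fin; apply: le_trans (hB n); exact: wgt_le_ell_norm.
have [k0|noI] := pselect (exists l : I, True); last first.
  have sn n : s n = 0.
    have : usum_to (fun l => M k l (h n l)) (\sum_(l <- fset0%fset) M k l (h n l)).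
      by apply: usum_to_fset => l; case: noI; exists l.
    by rewrite big_seq_fset0; exact: usum_to_uniq (hs n).
  apply/vcvg0P => e e0; exists 0%N => n _; by rewrite sn vnorm0.
have B0 : 0 <= B.
  by have [l _] := k0; exact: le_trans (wgt_ge0 w_gt0 (h 0%N) l) (wB 0%N l).
(* The dominating family combines [vnorm (h n l) <= B / w l] with the operator norm of the entry. *)
apply: (usum_to_dominated exh (a := fun l => B * (opnorm (M k l) / w l)) (B := B * S)
          (h := fun n l => M k l (h n l))) => //.
- by move=> G; rewrite -mulr_sumr ler_wpM2l.
- move=> n l; apply: le_trans (le_opnorm (bM l) _) _.
  rewrite mulrA ler_pdivlMr // -mulrA mulrC ler_wpM2r ?opnorm_ge0 //.
  exact: wB.
- move=> l; rewrite -(bop0 (bM l)); apply: continuous_cvg; last exact: h0.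
  exact: (bM l).2.
Qed.

(** Carries bounded coordinatewise null behavior from [U] to [W]. Empty [F n] serves to compare the
    two equivalence relations; an exhaustion serves for the partial sums of the expansion. *)
Lemma dual_pair_cvg0 U W (z : nat -> H) (F : nat -> {fset I}) (c : I -> H) (B : R) :
  dual_pair dot A U W ->
  (forall l, (U l (z n) - trunc (F n) c l) @[n --> \oo] --> (0 : H)) ->
  (forall n, (ell_norm +oo w (analysis U (z n) - trunc (F n) c)%R <= B%:E)%E) ->
  (forall k, W k (z n - fsynth dot W (F n) c) @[n --> \oo] --> (0 : H)) /\
  exists2 B' : R, 0 <= B' &
    forall n, (qnorm w +oo W (z n - fsynth dot W (F n) c)%R <= B'%:E)%E.
Proof.
move=> UW h0 hB; have [bU bW AW _] := UW; split.
  move=> k; apply: (row_cvg0 (k := k) AW hB h0) => n.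
  exact: (dual_pair_usum salg).
have [C C0 hC] := dual_pair_bound exh salg p0_gt0 w_gt0 adm UW hoo.
exists (C * `|B|) => [|n]; first by rewrite mulr_ge0 // ltW.
apply: le_trans (hC _ _ _ (ell_oo_bound (hB n))).2 _.
rewrite EFinM lee_pmul ?ell_norm_ge0 ?lee_fin ?(ltW C0) //.
by apply: le_trans (hB n) _; rewrite lee_fin ler_norm.
Qed.

Lemma equivalent_ooP U (u v : nat -> H) : equivalent_oo w U u v <->
  (forall k, U k (u n - v n) @[n --> \oo] --> (0 : H)) /\
  exists2 B : R, 0 <= B & forall n, (qnorm w +oo U (u n - v n)%R <= B%:E)%E.
Proof.
by rewrite /equivalent_oo /= ereal_sup_ltyP // => n; exact: ell_norm_ge0.
Qed.

Lemma equivalent_oo_dual_sub U W (u v : nat -> H) : dual_pair dot A U W ->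
  equivalent_oo w U u v -> equivalent_oo w W u v.
Proof.
move=> UW /equivalent_ooP [uv [B _ hB]]; apply/equivalent_ooP.
have [|n|] := @dual_pair_cvg0 U W (fun n => u n - v n) (fun=> fset0) 0 B UW.
- move=> l; have -> : (fun n => U l (u n - v n) - trunc fset0 0 l) =
      (fun n => U l (u n - v n)) by apply/funext => n; rewrite trunc_fset0 subr0.
  exact: uv.
- by rewrite trunc_fset0 subr0; exact: hB.
move=> h [B' B'0 hB']; split=> [k|].
  have -> : (fun n => W k (u n - v n)) =
      (fun n => W k (u n - v n - fsynth dot W fset0 0)).
    by apply/funext => n; rewrite fsynth_fset0 subr0.
  exact: h.
by exists B' => // n; have := hB' n; rewrite fsynth_fset0 subr0.
Qed.

Lemma equivalent_oo_dual U W (u : nat -> H) : dual_pair dot A U W ->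
  dual_pair dot A W U -> equivalent_oo w U u = equivalent_oo w W u.
Proof.
by move=> UW WU; rewrite eqEsubset; split=> v; exact: equivalent_oo_dual_sub.
Qed.

Definition bounded_cvg U (u : nat -> H) :=
  (forall k, cvg (U k (u n) @[n --> \oo])) /\
  (ereal_sup (range (fun n => qnorm w +oo U (u n))) < +oo)%E.

Lemma bounded_cvgP U u : bounded_cvg U u <->
  exists c : I -> H, (forall k, U k (u n) @[n --> \oo] --> c k) /\
    exists2 B : R, 0 <= B & forall n, (qnorm w +oo U (u n) <= B%:E)%E.
Proof.
rewrite /bounded_cvg ereal_sup_ltyP; last by move=> n; exact: ell_norm_ge0.
split=> [[cu hB]|[c [cu hB]]]; last first.
  by split=> // k; apply/cvg_ex; exists (c k); exact: cu.
by exists (fun k => lim (U k (u n) @[n --> \oo])).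
Qed.

(* C_W u = G_{W,W} C_U u passes to the limit. *)
Lemma bounded_cvg_dual U W u c (B : R) : dual_pair dot A U W -> 0 <= B ->
  (forall k, U k (u n) @[n --> \oo] --> c k) ->
  (forall n, (qnorm w +oo U (u n) <= B%:E)%E) ->
  (forall k, W k (u n) @[n --> \oo] --> act (gram dot W W) c k) /\
  exists2 B' : R, 0 <= B' & forall n, (qnorm w +oo W (u n) <= B'%:E)%E.
Proof.
move=> UW B0 uc hB; have [bU bW AW _] := UW.
have [C C0 hC] := dual_pair_dominates exh salg p0_gt0 w_gt0 adm hoo UW.
split; last first.
  exists (C * B) => [|n]; first by rewrite mulr_ge0 // ltW.
  apply: le_trans (hC _ (ell_oo_bound (hB n))).2 _.
  by rewrite EFinM lee_pmul ?ell_norm_ge0 ?lee_fin ?(ltW C0).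
have cB : (ell_norm +oo w c <= B%:E)%E.
  apply: (ell_norm_fatou w_gt0 (u := fun n => analysis U (u n)) eo B0 uc).
  by exists 0%N => n _; exact: hB.
have cb : ell +oo w c := ell_oo_bound cB.
have [D hD] := adm AW (or_introl (ltry p0)).
have [cv _ _] := hD c cb.
have [E E0 hE] := ell_almost_triangle (H := H) w_gt0 eo ltr01.
move=> k; have [s hs] := cv k; rewrite /act (usumE exh hs).
(* The Fatou lemma bounds [c] by the same [B] as the sequence, so the almost triangle inequality
   with [e = 1] bounds the difference. *)
apply/vcvg_dist; apply: (@row_cvg0 (gram dot W W) k
  (fun n => analysis U (u n) - c) _ ((1 + 1) * B + E * B)) => //.
- move=> n; apply: le_trans (hE _ _) _; rewrite (ell_normN w_gt0 c eo).
  by apply: lee_comb; rewrite ?ell_norm_ge0 ?(ltW E0) //; exact: hB.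
- by move=> l; exact: ((vcvg_dist _ _).1 (uc l)).
- move=> n; have := @dual_pair_usum _ _ _ _ _ _ salg U W (u n) 0 fset0 k UW.
  rewrite fsynth_fset0 subr0 => h.
  have -> : (fun l => gram dot W W k l ((analysis U (u n) - c) l)) =
     (fun l => gram dot W W k l (U l (u n) - trunc fset0 0 l) - gram dot W W k l (c l)).
    apply/funext => l; rewrite trunc_fset0 subr0.
    by rewrite -(bopB (sa_entries salg AW k l)).
  exact: usum_toB.
Qed.

Lemma equivalent_oo_refl U u : (forall k, bounded_op (U k)) -> equivalent_oo w U u u.
Proof.
move=> bU; apply/equivalent_ooP; split=> [k|].
  apply/vcvg0P => e e0; exists 0%N => n _.
  by rewrite subrr (bop0 (bU k)) vnorm0.
by exists 0 => // n; rewrite subrr (qnorm0 w_gt0 eo bU).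
Qed.

Lemma equivalent_oo_cvg U u v c : (forall k, bounded_op (U k)) ->
  (forall k, U k (u n) @[n --> \oo] --> c k) -> equivalent_oo w U u v ->
  forall k, U k (v n) @[n --> \oo] --> c k.
Proof.
move=> bU uc /equivalent_ooP [uv _] k.
apply/vcvgP => e e0; have e2 : 0 < e / 2 by rewrite divr_gt0.
have /vcvgP/(_ _ e2) [N1 h1] := uc k; have /vcvg0P/(_ _ e2) [N2 h2] := uv k.
exists (maxn N1 N2) => n; rewrite geq_max => /andP[/h1 n1 /h2 n2].
apply: le_lt_trans (vdist_trans (U k (u n)) _ _) _.
by rewrite (splitr e) ltrD // -(bopB (bU k)).
Qed.

Lemma equivalent_oo_ext U u c : (forall k, bounded_op (U k)) ->
  (forall k, U k (u n) @[n --> \oo] --> c k) -> ext U (equivalent_oo w U u) = c.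
Proof.
move=> bU uc; apply/funext => k; apply: cvg_lim; first exact: norm_hausdorff.
by apply: (equivalent_oo_cvg bU uc); exact: (getI (equivalent_oo_refl u bU)).
Qed.

Lemma Hspace_ooE U : Hspace_oo w U = [set equivalent_oo w U u | u in bounded_cvg U].
Proof. by []. Qed.

Lemma Hspace_oo_dual_sub U W : dual_pair dot A U W -> dual_pair dot A W U ->
  Hspace_oo w U `<=` Hspace_oo w W.
Proof.
move=> UW WU; rewrite !Hspace_ooE => _ [u /bounded_cvgP [c [uc [B B0 hB]]] <-].
rewrite (equivalent_oo_dual u UW WU); exists u => //.
apply/bounded_cvgP; exists (act (gram dot W W) c).
exact: (bounded_cvg_dual UW B0 uc hB).
Qed.

(** The limit coefficients are related by the Gram matrix, as those of vectors of H are, so its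
    boundedness on l^oo is the whole estimate. *)
Lemma Hnorm_oo_dual U W : dual_pair dot A U W -> dual_pair dot A W U ->
  exists2 C : R, 0 < C & forall x, Hspace_oo w U x ->
    (Hnorm_oo w W x <= C%:E * Hnorm_oo w U x)%E.
Proof.
move=> UW WU; have [bU bW AW _] := UW.
have [C C0 hC] := bounded_on_admissible exh salg p0_gt0 w_gt0 adm AW hoo.
exists C => // _ [u /bounded_cvgP [c [uc [B B0 hB]]] <-].
have [Wc _] := bounded_cvg_dual UW B0 uc hB.
rewrite /Hnorm_oo (equivalent_oo_ext bU uc) (equivalent_oo_dual u UW WU).
rewrite (equivalent_oo_ext bW Wc).
have cB : (ell_norm +oo w c <= B%:E)%E.
  apply: (ell_norm_fatou w_gt0 (u := fun n => analysis U (u n)) eo B0 uc).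
  by exists 0%N => n _; exact: hB.
by have [_ _] := hC c (ell_oo_bound cB).
Qed.

(** Each fixed index ends up in [F n], where truncation changes nothing, and truncation never
    increases the sup-norm. So [u n] minus the partial sum is null in the [W]-relation, which has
    the same classes as the [U]-relation. *)
Lemma class_sum_to_dual U W x : dual_pair dot A U W -> dual_pair dot A W U ->
  Hspace_oo w U x -> class_sum_to (fun k => adj dot (W k) (ext U x k)) x.
Proof.
move=> UW WU [u /bounded_cvgP [c [uc [B B0 hB]]] <-] F eF.
have [bU bW AW _] := UW; rewrite (equivalent_oo_ext bU uc).
rewrite (equivalent_oo_dual u UW WU); apply/equivalent_ooP.
have cB : (ell_norm +oo w c <= B%:E)%E.
  apply: (ell_norm_fatou w_gt0 (u := fun n => analysis U (u n)) eo B0 uc).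
  by exists 0%N => n _; exact: hB.
have [E E0 hE] := ell_almost_triangle (H := H) w_gt0 eo ltr01.
apply: (@dual_pair_cvg0 U W u F c ((1 + 1) * B + E * B) UW) => [l|n].
  have [N hN] := exhaustion_sub [fset l]%fset eF.
  have /vcvgP h := uc l; apply/vcvg0P => e /h [N' hN'].
  exists (maxn N N') => n; rewrite geq_max => /andP[/hN lF /hN' lt].
  by rewrite /trunc (fsubsetP lF) ?inE // vdistC.
apply: le_trans (hE _ _) _; rewrite (ell_normN w_gt0 _ eo).
apply: lee_comb; rewrite ?ell_norm_ge0 ?(ltW E0) //; first exact: hB.
apply: le_trans cB; apply: (le_ell_norm w_gt0 eo) => l.
by rewrite /trunc; case: ifP => // _; rewrite vnorm0 vnorm_ge0.
Qed.

Lemma ext_wd_oo U x : (forall k, bounded_op (U k)) -> Hspace_oo w U x -> ext_wd U x.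
Proof.
move=> bU [u /bounded_cvgP [c [uc _]] <-] v uv k.
by rewrite (equivalent_oo_ext bU uc); exact: (equivalent_oo_cvg bU uc).
Qed.

(** Pairing with an element of [H00 dot U] involves finitely many coordinates [U l], which converge
    along any representative; the partial sums are themselves a representative, so one limit
    computation covers both sides. *)
Lemma sigma_sum_to_class U (h : I -> H) x : (forall k, bounded_op (U k)) ->
  ext_wd U x -> class_sum_to h x -> sigma_sum_to dot U h x.
Proof.
move=> bU wd cs F eF g Hg u xu.
have [G [c ->]] := H00P exh hilb salg bU Hg.
exists (\sum_(l <- G) dot (ext U x l) (c l)).
suff lim v : x v -> (dot (v n) (fsynth dot U G c) : (R[i])^o) @[n --> \oo] -->
    (\sum_(l <- G) dot (ext U x l) (c l) : (R[i])^o).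
  by split; apply: lim => //; exact: cs.
move=> xv.
have -> : (fun n => dot (v n) (fsynth dot U G c) : (R[i])^o) =
    (fun n => \sum_(l <- G) (dot (U l (v n)) (c l) : (R[i])^o)).
  apply/funext => n; rewrite /fsynth linear_sumr; apply: eq_bigr => l _.
  by apply/esym; exact: (adjP exh hilb salg l (bU l)).
elim: (enum_fset G) => [|l r IH].
  under eq_fun do rewrite big_nil.
  by rewrite big_nil; exact: cvg_cst.
under eq_fun do rewrite big_cons.
rewrite big_cons; apply: cvgD; last exact: IH.
by apply: cvg_dotl => //; exact: wd.
Qed.

Theorem coorbit_dual_infinite U W : dual_pair dot A U W -> dual_pair dot A W U ->
  [/\ Hspace_oo w U = Hspace_oo w W,
      equiv_norms (Hspace_oo w U) (Hnorm_oo w U) (Hnorm_oo w W) &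
      forall f, Hspace_oo w U f ->
        [/\ ext_wd U f, ext_wd W f,
            sigma_sum_to dot U (fun k => adj dot (W k) (ext U f k)) f /\
            class_sum_to (fun k => adj dot (W k) (ext U f k)) f &
            sigma_sum_to dot U (fun k => adj dot (U k) (ext W f k)) f /\
            class_sum_to (fun k => adj dot (U k) (ext W f k)) f]].
Proof.
move=> UW WU; have [bU bW _ _] := UW.
have sUW := Hspace_oo_dual_sub UW WU; have sWU := Hspace_oo_dual_sub WU UW.
split.
- by rewrite eqEsubset; split; [exact: sUW|exact: sWU].
- have [C1 C10 h1] := Hnorm_oo_dual UW WU; have [C2 C20 h2] := Hnorm_oo_dual WU UW.
  apply: (equiv_norms_of_le C10 C20) => x Ux; first exact: h1.
  by apply: h2; exact: sUW.
- move=> x Ux; have Wx := sUW _ Ux.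
  have wdU := ext_wd_oo bU Ux.
  (* [x] lies in both spaces, so the exchanged expansion also represents [x]; its convergence can
     therefore still be tested against [H00 dot U]. *)
  have csU := class_sum_to_dual UW WU Ux; have csW := class_sum_to_dual WU UW Wx.
  split; [exact: wdU|exact: (ext_wd_oo bW Wx)| |].
    by split; [exact: sigma_sum_to_class|exact: csU].
  by split; [exact: sigma_sum_to_class|exact: csW].
Qed.

End CoorbitInfinite.

Lemma countable_exhaustion (T : choiceType) (X : set T) : countable X ->
  exists F : nat -> {fset X}, exhaustion F.
Proof.
move=> /countable_injP [f fI].
(* Injectivity of [f] on [X] makes each sublevel set finite, whether [X] is finite or infinite. *)
pose S n : set X := [set k | (f (val k) <= n)%N].
have fS n : finite_set (S n).
  apply: (@sub_finite_set _ _ ((f \o val) @^-1` `I_n.+1)) => //.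
  apply: finite_preimage => [k l _ _ /= /fI E|]; last exact: finite_II.
  by apply: val_inj; apply: E; rewrite inE; exact: set_valP.
exists (fun n => fset_set (S n)); split=> [n|k].
  apply/fsubsetP => k; rewrite !in_fset_set // !inE /S /=; exact: leqW.
by exists (f (val k)); rewrite in_fset_set // inE /S /=.
Qed.

Theorem theorem3p26 (R : realType) (H : completeNormedModType R[i])
  (dot : {dot H for Num.conj}) (d : nat) (X : set 'rV[R]_d)
  (A : set (mx H X)) (nA : mx H X -> R) (p0 : R) (omega : 'rV[R]_d -> R)
  (T Td : X -> H -> H) (p : \bar R) :
  is_hilbert dot -> separable H ->
  countable X ->
  spectral_algebra dot A nA ->
  0 < p0 -> p0 <= 1 ->
  continuous omega -> (forall x, 0 < omega x) ->
  let w := (fun k : X => omega (val k)) in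
  admissible A p0 w ->
  g_frame T -> localized dot A T T ->
  dual_g_frame dot T Td -> localized dot A Td Td -> localized dot A Td T ->
  (p0%:E < p)%E \/ p = 0%E \/ p = 1%E ->
  ((p < +oo)%E ->
     [/\ Vspace w p Td = Vspace w p T,
         equiv_norms (Vspace w p Td) (qnorm w p Td) (qnorm w p T),
         Hspace dot w p Td T = Hspace dot w p T Td,
         equiv_norms (Hspace dot w p Td T) (Hnorm w p Td) (Hnorm w p T) &
         forall f, Hspace dot w p Td T f ->
           [/\ ext_wd Td f, ext_wd T f,
               Hspace_sum_to dot w p Td T
                 (fun k => adj dot (T k) (ext Td f k)) f &
               Hspace_sum_to dot w p Td T
                 (fun k => adj dot (Td k) (ext T f k)) f]]) /\
  (p = +oo%E ->
     [/\ Hspace_oo w Td = Hspace_oo w T,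
         equiv_norms (Hspace_oo w Td) (Hnorm_oo w Td) (Hnorm_oo w T) &
         forall f, Hspace_oo w Td f ->
           [/\ ext_wd Td f, ext_wd T f,
               sigma_sum_to dot Td (fun k => adj dot (T k) (ext Td f k)) f /\
               class_sum_to (fun k => adj dot (T k) (ext Td f k)) f &
               sigma_sum_to dot Td (fun k => adj dot (Td k) (ext T f k)) f /\
               class_sum_to (fun k => adj dot (Td k) (ext T f k)) f]]).
Proof.
move=> hilb _ cX salg p0_gt0 _ _ om_gt0 w adm [bT _] AT [[bTd _] D] ATd _ hp.
have exh := countable_exhaustion cX.
have w_gt0 k : 0 < w k by exact: om_gt0.
(* The two expansions in the definition of a dual g-frame supply one ordered pair each. *)
have TdT : dual_pair dot A Td T by split=> // f; exact: (D f).1.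
have TTd : dual_pair dot A T Td by split=> // f; exact: (D f).2.
split=> [poo|_].
  exact: (coorbit_dual_finite exh hilb salg p0_gt0 w_gt0 adm hp poo TdT TTd).
exact: (coorbit_dual_infinite exh hilb salg p0_gt0 w_gt0 adm TdT TTd).
Qed.
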